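(* Let $\Lambda\subset\mathbb{C}$ be an unbounded set with a unique limit direction at infinity, $P(\Lambda)=\{s_\omega\}$, and let $\{\lambda_n\}\subset\Lambda$ be any sequence with $|\lambda_{n+1}|>2|\lambda_n|$ for all $n$. Let $M=\{\mu_k\}_{k\ge1}\subset\mathbb{C}$ be a countably infinite set of nodes with multiplicities $m_k\in\mathbb{N}$, such that no point of $M$ is a limit point of $M$, and such that for every $c\in\mathbb{R}$ the line $\{z\in\mathbb{C}:\operatorname{Re}(s_\omega z)=c\}$ contains at most one node of $M$. Let $d(s_\omega,M)=\sup_{k}\operatorname{Re}(s_\omega\mu_k)\in\mathbb{R}\cup\{+\infty\}$ and $\Pi=\{z\in\mathbb{C}:\operatorname{Re}(s_\omega z)<d(s_\omega,M)\}$. Say that the interpolation problem is soluble if for arbitrary data $b_k^j\in\mathbb{C}$ ($k\in\mathbb{N}$, $0\le j\le m_k-1$) there exists a series $\sum_{n}c_ne^{\lambda_nz}$ that converges absolutely in a neighborhood of every node $\mu_k$ and whose sum $U$ satisfies $U^{(j)}(\mu_k)=b_k^j$ for all $k$ and $0\le j\le m_k-1$ (such a series converges absolutely in $\Pi$, so $U\in H(\Pi)$). Then: 1. If $d(s_\omega,M)=+\infty$ (so $\Pi=\mathbb{C}$), the interpolation problem is soluble if and only if $\lim_{k\to\infty}\operatorname{Re}(s_\omega\mu_k)=+\infty$. 2. If $d(s_\omega,M)<+\infty$ (so $\Pi$ is a half-plane), the interpolation problem is soluble if and only if $\operatorname{Re}(s_\omega\mu_k)<d(s_\omega,M)$ for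 all $k$ and $\lim_{k\to\infty}\operatorname{Re}(s_\omega\mu_k)=d(s_\omega,M)$.
   Context: $\mathbb{S}=\{s\in\mathbb{C}:|s|=1\}$. For an unbounded set $X\subset\mathbb{C}$, the set $P(X)\subset\mathbb{S}$ of limit directions at infinity consists of all $s\in\mathbb{S}$ such that $s=\lim_{k\to\infty}x_k/|x_k|$ for some sequence $\{x_k\}\subset X$ with $x_k\to\infty$. $H(\Pi)$ denotes the space of holomorphic functions on $\Pi$. The limits over $k\to\infty$ are limits along the (injective) enumeration of $M$, i.e. convergence along the filter of cofinite subsets of $M$. *)

(* Defs.v *)
From Stdlib Require Export Reals Lra.
Open Scope R_scope.

Definition Cx : Type := (R * R)%type.
Definition Re (z : Cx) : R := fst z.
Definition Im (z : Cx) : R := snd z.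
Definition Cadd (z w : Cx) : Cx := (fst z + fst w, snd z + snd w).
Definition Csub (z w : Cx) : Cx := (fst z - fst w, snd z - snd w).
Definition Cmul (z w : Cx) : Cx :=
  (fst z * fst w - snd z * snd w, fst z * snd w + snd z * fst w).
Definition Cnorm (z : Cx) : R := sqrt (fst z * fst z + snd z * snd z).
Definition Cinv (z : Cx) : Cx :=
  (fst z / (fst z * fst z + snd z * snd z),
   - snd z / (fst z * fst z + snd z * snd z)).
Definition Cdiv (z w : Cx) : Cx := Cmul z (Cinv w).
Definition Cscal (a : R) (z : Cx) : Cx := (a * fst z, a * snd z).
Definition Cexp (z : Cx) : Cx := (exp (fst z) * cos (snd z), exp (fst z) * sin (snd z)).

Fixpoint Cpsum (a : nat -> Cx) (n : nat) : Cx :=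
  match n with
  | O => a O
  | S p => Cadd (Cpsum a p) (a (S p))
  end.

Definition Cseries_abs_sum (a : nat -> Cx) (S : Cx) : Prop :=
  (exists l : R, Un_cv (sum_f_R0 (fun i => Cnorm (a i))) l) /\
  (forall eps : R, eps > 0 -> exists N : nat, forall n : nat, (n >= N)%nat ->
      Cnorm (Csub (Cpsum a n) S) < eps).

Definition Cderiv (f : Cx -> Cx) (z l : Cx) : Prop :=
  forall eps : R, eps > 0 -> exists delta : R, delta > 0 /\
    forall h : Cx, 0 < Cnorm h < delta ->
      Cnorm (Csub (Cdiv (Csub (f (Cadd z h)) (f z)) h) l) < eps.

Fixpoint nth_deriv_at (n : nat) (f : Cx -> Cx) (z b : Cx) : Prop :=
  match n with
  | O => f z = b
  | S p => exists r : R, r > 0 /\ exists g : Cx -> Cx,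
             (forall w : Cx, Cnorm (Csub w z) < r -> Cderiv f w (g w)) /\
             nth_deriv_at p g z b
  end.

Definition limit_direction (X : Cx -> Prop) (s : Cx) : Prop :=
  Cnorm s = 1 /\
  exists x : nat -> Cx,
    (forall k, X (x k)) /\
    (forall A : R, exists K : nat, forall k, (k >= K)%nat -> Cnorm (x k) > A) /\
    (forall eps : R, eps > 0 -> exists K : nat, forall k, (k >= K)%nat ->
        Cnorm (Csub (Cscal (/ Cnorm (x k)) (x k)) s) < eps).

Definition unbounded (X : Cx -> Prop) : Prop :=
  forall A : R, exists x : Cx, X x /\ Cnorm x > A.

Definition interpolation_soluble (lam : nat -> Cx) (mu : nat -> Cx) (m : nat -> nat) : Prop :=
  forall b : nat -> nat -> Cx,
    exists c : nat -> Cx, exists U : Cx -> Cx,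
      (forall k : nat, exists r : R, r > 0 /\
         forall z : Cx, Cnorm (Csub z (mu k)) < r ->
           Cseries_abs_sum (fun n => Cmul (c n) (Cexp (Cmul (lam n) z))) (U z)) /\
      (forall k j : nat, (j < m k)%nat -> nth_deriv_at j U (mu k) (b k j)).

(* Main.v *)
(* Along the direction of [s] the exponentials with frequencies [lam n] are totally ordered by
   growth. With [x k = Re (s mu_k)], a series converging at [mu p] is bounded on the half-plane
   [Re (s z) < x p] by a constant times a function independent of its coefficients, so data
   growing faster on infinitely many nodes there cannot be interpolated: solubility forces that,
   for each [p], all but finitely many [k] satisfy [x p < x k]. Conversely, under this condition
   the nodes can be listed by increasing [x], and in the lexicographic order of pairs (node,
   derivative) each row of the system [sum_n c_n lam_n^j exp (lam_n mu_k) = b_k^j] is negligible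
   with respect to the next one as [n] grows. Such an infinite system is soluble (Polya): a block
   of coefficients placed far out fixes one new row, leaves the earlier rows exact, and
   contributes to them an absolutely convergent amount. Both limit conditions of the theorem
   are reformulations of the condition on [x]. *)
From Stdlib Require Import Reals Lra Lia List FinFun.
From Stdlib Require Import ClassicalEpsilon ClassicalChoice FunctionalExtensionality.
From Coquelicot Require Import Coquelicot.
Require Import Defs.
Open Scope R_scope.

Local Notation C := Complex.C.

(** * Partial sums of complex sequences *)

Lemma Cnorm_Cmod (z : C) : Cnorm z = Cmod z.
Proof. unfold Cnorm, Cmod. f_equal. ring. Qed.

Lemma Cpsum_ext (f g : nat -> C) N :
  (forall n, (n <= N)%nat -> f n = g n) -> Cpsum f N = Cpsum g N.
Proof.
  induction N as [|N IH]; intros H; simpl.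
  - apply H; lia.
  - rewrite IH, (H (S N)); auto.
Qed.

Lemma Cpsum_plus (f g : nat -> C) N :
  Cpsum (fun n => (f n + g n)%C) N = (Cpsum f N + Cpsum g N)%C.
Proof.
  induction N as [|N IH]; simpl; [reflexivity|].
  rewrite IH. unfold Cadd, Cplus; simpl. f_equal; ring.
Qed.

Lemma Cpsum_scal (k : C) (f : nat -> C) N :
  Cpsum (fun n => (k * f n)%C) N = (k * Cpsum f N)%C.
Proof.
  induction N as [|N IH]; simpl; [reflexivity|].
  rewrite IH. unfold Cadd, Cmult; simpl. f_equal; ring.
Qed.

Lemma Cpsum_stable (f : nat -> C) N M :
  (N <= M)%nat -> (forall n, (N < n)%nat -> f n = RtoC 0) -> Cpsum f M = Cpsum f N.
Proof.
  intros H Hf. induction H as [|M H IH]; [reflexivity|].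
  simpl. rewrite IH, (Hf (S M)) by lia. unfold Cadd, RtoC; simpl.
  rewrite !Rplus_0_r. symmetry. apply surjective_pairing.
Qed.

Lemma Cpsum_single (f : nat -> C) N :
  (forall n, (n < N)%nat -> f n = RtoC 0) -> Cpsum f N = f N.
Proof.
  destruct N as [|N]; [reflexivity|]. intros Hf. simpl.
  replace (Cpsum f N) with (RtoC 0).
  - unfold Cadd, RtoC; simpl. rewrite !Rplus_0_l. symmetry. apply surjective_pairing.
  - induction N as [|N IH]; simpl; [symmetry; apply Hf; lia|].
    rewrite <- IH, (Hf (S N)) by (lia || (intros; apply Hf; lia)).
    unfold Cadd, RtoC; simpl. now rewrite !Rplus_0_r.
Qed.

Lemma sum_single (f : nat -> R) N :
  (forall n, (n < N)%nat -> f n = 0) -> sum_f_R0 f N = f N.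
Proof.
  destruct N as [|N]; [reflexivity|]. intros Hf. simpl.
  rewrite (sum_eq_R0 f N); [ring|]. intros n Hn. apply Hf. lia.
Qed.

Lemma Cpsum_Cmod_le (f : nat -> C) N :
  Cmod (Cpsum f N) <= sum_f_R0 (fun n => Cmod (f n)) N.
Proof.
  induction N as [|N IH]; simpl; [lra|].
  eapply Rle_trans; [apply Cmod_triangle|]. lra.
Qed.

Lemma Cpsum_diff_le (f : nat -> C) N M :
  (N <= M)%nat ->
  Cmod (Cpsum f M - Cpsum f N) <=
  sum_f_R0 (fun n => Cmod (f n)) M - sum_f_R0 (fun n => Cmod (f n)) N.
Proof.
  induction 1 as [|M H IH].
  - replace (Cpsum f N - Cpsum f N)%C with (RtoC 0) by ring.
    rewrite Cmod_0. lra.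
  - simpl.
    replace (Cadd (Cpsum f M) (f (S M)) - Cpsum f N)%C
      with ((Cpsum f M - Cpsum f N) + f (S M))%C
      by (change (Cadd (Cpsum f M) (f (S M))) with (Cplus (Cpsum f M) (f (S M))); ring).
    eapply Rle_trans; [apply Cmod_triangle|]. lra.
Qed.

(** * Infinite linear systems *)

Section Polya.
Variable a : nat -> nat -> C.
Hypothesis a_neq0 : forall i, exists N, forall n, (N <= n)%nat -> a i n <> RtoC 0.
Hypothesis a_small : forall i eps, 0 < eps -> exists N, forall n, (N <= n)%nat ->
  Cmod (a i n) <= eps * Cmod (a (S i) n).

Lemma row_small l i eps : (l < i)%nat -> 0 < eps -> exists N, forall n, (N <= n)%nat ->
  Cmod (a l n) <= eps * Cmod (a i n).
Proof.
  intros Hl; revert eps. induction Hl as [|i Hl IH]; intros eps He; [now apply a_small|].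
  destruct (IH eps He) as [N1 H1]. destruct (a_small i 1 Rlt_0_1) as [N2 H2].
  exists (N1 + N2)%nat. intros n Hn.
  eapply Rle_trans; [apply H1; lia|].
  apply Rmult_le_compat_l; [lra|]. rewrite <- (Rmult_1_l (Cmod (a (S i) n))). apply H2; lia.
Qed.

Lemma rows_small i j eps : (j <= i)%nat -> 0 < eps -> exists N, forall n l, (N <= n)%nat -> (l < j)%nat ->
  Cmod (a l n) <= eps * Cmod (a i n).
Proof.
  intros Hj He. induction j as [|j IH].
  - exists 0%nat. intros; lia.
  - destruct IH as [N1 H1]; [lia|]. destruct (row_small j i eps) as [N2 H2]; [lia|exact He|].
    exists (N1 + N2)%nat. intros n l Hn Hl.
    destruct (Nat.eq_dec l j) as [->|]; [apply H2; lia|apply H1; lia].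
Qed.

(** A block placed after index [N]: adding it to a vector leaves the entries up to [N] unchanged. *)
Definition supported (v : nat -> C) (N M : nat) :=
  forall n, (n <= N)%nat \/ (M < n)%nat -> v n = RtoC 0.

Definition row (v : nat -> C) (M i : nat) : C := Cpsum (fun n => a i n * v n)%C M.

(** The absolute mass of an equation; keeping it bounded along the construction makes the final
    series absolutely convergent. *)
Definition rowabs (v : nat -> C) (M i : nat) : R :=
  sum_f_R0 (fun n => Cmod (a i n * v n)) M.

Lemma row_stable v N M M' i : supported v N M -> (M <= M')%nat -> row v M' i = row v M i.
Proof.
  intros Hv H. apply Cpsum_stable; [exact H|]. intros n Hn.
  rewrite Hv by lia. apply Cmult_0_r.
Qed.

Lemma rowabs_stable v N M M' i : supported v N M -> (M <= M')%nat -> rowabs v M' i = rowabs v M i.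
Proof.
  intros Hv H. unfold rowabs. induction H as [|M' H IH]; [reflexivity|].
  simpl. rewrite IH, (Hv (S M')) by lia. rewrite Cmult_0_r, Cmod_0. ring.
Qed.

Lemma row_bound v M i B : (forall n, Cmod (v n) <= B) ->
  rowabs v M i <= sum_f_R0 (fun n => Cmod (a i n)) M * B.
Proof.
  intros H. unfold rowabs. rewrite Rmult_comm, scal_sum.
  apply sum_Rle. intros n _. rewrite Cmod_mult.
  apply Rmult_le_compat_l; [apply Cmod_ge_0|apply H].
Qed.

Lemma row_le_rowabs v M i : Cmod (row v M i) <= rowabs v M i.
Proof. apply Cpsum_Cmod_le. Qed.

Lemma row_comb v w k M i :
  row (fun n => v n + k * w n)%C M i = (row v M i + k * row w M i)%C.
Proof.
  unfold row. rewrite <- Cpsum_scal, <- Cpsum_plus. apply Cpsum_ext. intros n _. ring.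
Qed.

(** A bounded right inverse of the first [i] rows, acting beyond any prescribed index. [M] and [K]
    are fixed before [beta], so a column of the system chosen beyond [M] may itself serve as
    right-hand side. *)
Definition solvable_rows (i : nat) : Prop := forall N, exists M K, (N <= M)%nat /\ 0 <= K /\
  forall beta delta, 0 <= delta -> (forall l, (l < i)%nat -> Cmod (beta l) <= delta) ->
    exists v, supported v N M /\ (forall l, (l < i)%nat -> row v M l = beta l) /\
      forall n, Cmod (v n) <= K * delta.

Lemma rows_abs_max i M : exists S, 0 <= S /\
  forall l, (l <= i)%nat -> sum_f_R0 (fun n => Cmod (a l n)) M <= S.
Proof.
  assert (P : forall l, 0 <= sum_f_R0 (fun n => Cmod (a l n)) M)
    by (intros l; apply cond_pos_sum; intros; apply Cmod_ge_0).
  exists (sum_f_R0 (fun l => sum_f_R0 (fun n => Cmod (a l n)) M) i).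
  split; [apply cond_pos_sum; exact P|].
  induction i as [|i IH]; intros l Hl; simpl.
  - replace l with 0%nat by lia. lra.
  - destruct (Nat.eq_dec l (S i)) as [->|].
    + assert (0 <= sum_f_R0 (fun l => sum_f_R0 (fun n => Cmod (a l n)) M) i)
        by (apply cond_pos_sum; exact P). lra.
    + specialize (IH l ltac:(lia)). specialize (P (S i)). lra.
Qed.

(* A unit vector far out is nearly a multiple of the dual vector of row [i]; the bounded
   solution operator of the rows before [i] removes the error. *)
Lemma dual_vector i : solvable_rows i -> forall N eps, 0 < eps ->
  exists M w, (N < M)%nat /\ supported w N M /\ (forall l, (l < i)%nat -> row w M l = RtoC 0) /\
    row w M i = RtoC 1 /\ forall l, (l < i)%nat -> rowabs w M l <= eps.
Proof.
  intros Hs N eps He. destruct (Hs N) as (M & K & HNM & HK & Hsol).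
  destruct (rows_abs_max i M) as (S & HS & HSl).
  set (D := 1 + S * K).
  assert (HD : 1 <= D) by (unfold D; nra).
  (* [eta * D <= 1/2] keeps the pivot [den] at least [A / 2]; [eta * D <= eps / 2] makes the final
     bound [2 * (eta * D)] on the earlier rows at most [eps]. *)
  set (eta := Rmin (/ 2) (eps / 2) / D).
  assert (Heta : 0 < eta).
  { unfold eta. apply Rdiv_lt_0_compat; [|lra]. apply Rmin_glb_lt; lra. }
  assert (HetaD : eta * D <= / 2 /\ eta * D <= eps / 2).
  { replace (eta * D) with (Rmin (/ 2) (eps / 2)) by (unfold eta; field; lra).
    split; [apply Rmin_l|apply Rmin_r]. }
  destruct HetaD as [HD1 HD2].
  destruct (rows_small i i eta) as [N1 H1]; [lia|exact Heta|].
  destruct (a_neq0 i) as [N2 H2].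
  set (n0 := (N1 + N2 + M + 1)%nat).
  specialize (H1 n0). assert (H3 : a i n0 <> RtoC 0) by (apply H2; unfold n0; lia).
  set (A := Cmod (a i n0)).
  assert (HA : 0 < A) by (apply Cmod_gt_0; exact H3).
  (* [u] reproduces column [n0] on the rows before [i], so the difference of the unit vector at [n0]
     and [u] vanishes on them. As those entries are at most [eta * A], [u] contributes at most half
     of the pivot entry to row [i]. *)
  destruct (Hsol (fun l => a l n0) (eta * A)) as (u & Hu & Hrow & Hub).
  { nra. } { intros l Hl. apply H1; [unfold n0; lia|exact Hl]. }
  assert (Huabs : forall l, (l <= i)%nat -> rowabs u n0 l <= S * K * eta * A).
  { intros l Hl. replace (rowabs u n0 l) with (rowabs u M l).
    - eapply Rle_trans; [apply row_bound; exact Hub|].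
      replace (S * K * eta * A) with (S * (K * (eta * A))) by ring.
      apply Rmult_le_compat_r; [|apply HSl; exact Hl].
      apply Rmult_le_pos; [exact HK|]. nra.
    - symmetry. apply (rowabs_stable u N); [exact Hu|unfold n0; lia]. }
  set (e := fun n => if Nat.eq_dec n n0 then RtoC 1 else RtoC 0).
  assert (He0 : forall l, row e n0 l = a l n0).
  { intros l. unfold row. rewrite Cpsum_single.
    - unfold e. destruct (Nat.eq_dec n0 n0); [|lia]. apply Cmult_1_r.
    - intros n Hn. unfold e. destruct (Nat.eq_dec n n0); [lia|]. apply Cmult_0_r. }
  set (den := (a i n0 - row u n0 i)%C).
  assert (Hden : A / 2 <= Cmod den).
  { assert (T : A <= Cmod den + Cmod (row u n0 i)).
    { unfold A, den. replace (a i n0) with ((a i n0 - row u n0 i) + row u n0 i)%C at 1 by ring.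
      apply Cmod_triangle. }
    pose proof (row_le_rowabs u n0 i). pose proof (Huabs i (le_n i)).
    assert (S * K * eta * A <= A / 2); [|lra].
    replace (A / 2) with (/ 2 * A) by field. apply Rmult_le_compat_r; [lra|].
    unfold D in HD1. nra. }
  assert (Hden0 : den <> RtoC 0) by (intros E; rewrite E, Cmod_0 in Hden; lra).
  set (w := fun n => (/ den * (e n + - RtoC 1 * u n))%C).
  assert (Hw : forall l, row w n0 l = (/ den * (a l n0 - row u n0 l))%C).
  { intros l.
    replace (row w n0 l) with (/ den * row (fun n => e n + - RtoC 1 * u n) n0 l)%C.
    - rewrite row_comb, He0. f_equal. ring.
    - unfold row. rewrite <- Cpsum_scal. apply Cpsum_ext. intros n _. unfold w. ring. }
  exists n0, w. split; [unfold n0; lia|]. split; [|split; [|split]].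
  - intros n Hn. unfold w. rewrite Hu by (unfold n0 in Hn; lia).
    unfold e. destruct (Nat.eq_dec n n0); [unfold n0 in *; lia|]. ring.
  - intros l Hl. rewrite Hw.
    rewrite (row_stable u N M n0 l Hu) by (unfold n0; lia). rewrite Hrow by exact Hl. ring.
  - rewrite Hw. unfold den. field. exact Hden0.
  - intros l Hl.
    assert (T : rowabs w n0 l <= / Cmod den * (Cmod (a l n0) + rowabs u n0 l)).
    { rewrite <- Cmod_inv by exact Hden0.
      assert (E : Cmod (a l n0) = rowabs e n0 l).
      { unfold rowabs. rewrite sum_single.
        - unfold e. destruct (Nat.eq_dec n0 n0); [|lia]. now rewrite Cmult_1_r.
        - intros n Hn. unfold e. destruct (Nat.eq_dec n n0); [lia|].
          now rewrite Cmult_0_r, Cmod_0. }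
      rewrite E. unfold rowabs. rewrite <- plus_sum, scal_sum. apply sum_Rle. intros n _.
      unfold w.
      replace (a l n * (/ den * (e n + - RtoC 1 * u n)))%C
        with (/ den * (a l n * e n + - (a l n * u n)))%C by ring.
      rewrite Cmod_mult, Rmult_comm. apply Rmult_le_compat_r; [apply Cmod_ge_0|].
      eapply Rle_trans; [apply Cmod_triangle|]. rewrite Cmod_opp. lra. }
    eapply Rle_trans; [exact T|].
    assert (T1 : Cmod (a l n0) <= eta * A) by (apply H1; [unfold n0; lia|exact Hl]).
    assert (T2 := Huabs l ltac:(lia)).
    apply Rle_trans with (/ (A / 2) * (eta * D * A)).
    + apply Rmult_le_compat.
      * left; apply Rinv_0_lt_compat; lra.
      * apply Rplus_le_le_0_compat; [apply Cmod_ge_0|].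
        apply cond_pos_sum; intros; apply Cmod_ge_0.
      * apply Rinv_le_contravar; lra.
      * unfold D. lra.
    + replace (/ (A / 2) * (eta * D * A)) with (2 * (eta * D)) by (field; lra). lra.
Qed.

Lemma supported_bounded v N M : supported v N M -> exists B, 0 <= B /\ forall n, Cmod (v n) <= B.
Proof.
  intros Hv. assert (P : 0 <= sum_f_R0 (fun n => Cmod (v n)) M)
    by (apply cond_pos_sum; intros; apply Cmod_ge_0).
  exists (sum_f_R0 (fun n => Cmod (v n)) M). split; [exact P|]. intros n.
  destruct (Nat.le_gt_cases n M) as [H|H].
  - clear Hv P. induction M as [|M IH]; simpl.
    + replace n with 0%nat by lia. lra.
    + pose proof (Cmod_ge_0 (v (S M))).
      destruct (Nat.eq_dec n (S M)) as [->|].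
      * assert (0 <= sum_f_R0 (fun n => Cmod (v n)) M)
          by (apply cond_pos_sum; intros; apply Cmod_ge_0). lra.
      * specialize (IH ltac:(lia)). lra.
  - rewrite Hv by lia. rewrite Cmod_0. exact P.
Qed.

(** By induction: a first block solves the earlier rows, and a multiple of the dual vector of the
    new row, placed on a later block, corrects that row without disturbing the others. *)
Lemma solvable_rows_all i : solvable_rows i.
Proof.
  induction i as [|i IH]; intros N.
  - exists N, 0. split; [lia|]. split; [lra|]. intros beta delta Hd _.
    exists (fun _ => RtoC 0). split; [intros n _; reflexivity|].
    split; [intros; lia|]. intros n. rewrite Cmod_0. lra.
  - destruct (IH N) as (M & K & HNM & HK & Hsol).
    destruct (dual_vector i IH M 1 Rlt_0_1) as (M' & w & HMM & Hw & Hw0 & Hw1 & _).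
    destruct (supported_bounded w M M' Hw) as (B & HB & HwB).
    destruct (rows_abs_max i M) as (T & HT & HTl).
    (* [K] bounds the first block; the defect of the new row is at most [(1 + T * K) * delta], and
       it multiplies a vector bounded by [B]. *)
    exists M', (K + (1 + T * K) * B). split; [lia|]. split.
    { assert (0 <= T * K) by nra. assert (0 <= (1 + T * K) * B) by nra. lra. }
    intros beta delta Hd Hbeta.
    destruct (Hsol beta delta Hd) as (u & Hu & Hrow & Hub); [intros; apply Hbeta; lia|].
    set (k := (beta i - row u M i)%C).
    assert (Hk : Cmod k <= (1 + T * K) * delta).
    { unfold k. eapply Rle_trans; [apply Cmod_triangle|]. rewrite Cmod_opp.
      assert (Cmod (row u M i) <= T * (K * delta)).
      { eapply Rle_trans; [apply row_le_rowabs|].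
        eapply Rle_trans; [apply row_bound; exact Hub|].
        apply Rmult_le_compat_r; [apply Rmult_le_pos; lra|apply HTl; lia]. }
      specialize (Hbeta i ltac:(lia)). lra. }
    exists (fun n => (u n + k * w n)%C). split; [|split].
    + intros n Hn. rewrite (Hw n) by lia. rewrite (Hu n) by lia. ring.
    + intros l Hl. rewrite row_comb, (row_stable u N M M' l Hu) by lia.
      destruct (Nat.eq_dec l i) as [->|].
      * rewrite Hw1. unfold k. ring.
      * rewrite Hw0, Hrow by lia. ring.
    + intros n. eapply Rle_trans; [apply Cmod_triangle|]. rewrite Cmod_mult.
      specialize (Hub n). specialize (HwB n).
      assert (Cmod k * Cmod (w n) <= ((1 + T * K) * delta) * B)
        by (apply Rmult_le_compat; auto using Cmod_ge_0).
      lra.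
Qed.

(** * Row-by-row construction of a solution of the infinite system *)

Variable b : nat -> C.

(** A state is a cut-off index with a coefficient vector read up to it. Stage [t] makes row [t]
    exact, and the summable increments [(/ 2) ^ t] keep the absolute mass of each earlier row
    bounded. *)
Definition extends (t : nat) (st st' : nat * (nat -> C)) : Prop :=
  (fst st < fst st')%nat /\
  (forall n, (n <= fst st)%nat -> snd st' n = snd st n) /\
  (forall l, (l < t)%nat -> row (snd st') (fst st') l = row (snd st) (fst st) l) /\
  row (snd st') (fst st') t = b t /\
  (forall l, (l < t)%nat ->
     rowabs (snd st') (fst st') l <= rowabs (snd st) (fst st) l + (/ 2) ^ t).

Lemma extends_ex t st : exists st', extends t st st'.
Proof.
  destruct st as [N c0].
  set (c := fun n => if Compare_dec.le_dec n N then c0 n else RtoC 0).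
  set (beta := (b t - row c0 N t)%C).
  assert (Hp : 0 < (/ 2) ^ t) by (apply pow_lt; lra).
  pose proof (Cmod_ge_0 beta) as Hbeta.
  (* The dual vector is scaled by the defect [beta] of row [t], so the tolerance is divided by its
     size; the added 1 covers [beta = 0]. *)
  destruct (dual_vector t (solvable_rows_all t) N ((/ 2) ^ t / (1 + Cmod beta)))
    as (M & w & HNM & Hw & Hw0 & Hw1 & Hwa).
  { apply Rdiv_lt_0_compat; lra. }
  assert (Hc : forall l, row c M l = row c0 N l).
  { intros l. unfold row. rewrite (Cpsum_stable _ N M).
    - apply Cpsum_ext. intros n Hn. unfold c. now destruct (Compare_dec.le_dec n N).
    - lia.
    - intros n Hn. unfold c. destruct (Compare_dec.le_dec n N); [lia|]. apply Cmult_0_r. }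
  exists (M, fun n => (c n + beta * w n)%C). unfold extends; simpl.
  split; [exact HNM|]. split; [|split; [|split]].
  - intros n Hn. rewrite (Hw n) by lia. unfold c. destruct (Compare_dec.le_dec n N); [ring|lia].
  - intros l Hl. rewrite row_comb, Hc, Hw0 by exact Hl. ring.
  - rewrite row_comb, Hc, Hw1. unfold beta. ring.
  - intros l Hl.
    assert (Hca : rowabs c M l = rowabs c0 N l).
    { unfold rowabs. clear - HNM. assert (HNM' : (N <= M)%nat) by lia. clear HNM.
      induction HNM' as [|M H IH]; simpl.
      - apply sum_eq. intros n Hn. unfold c. now destruct (Compare_dec.le_dec n N).
      - rewrite IH. unfold c. destruct (Compare_dec.le_dec (S M) N); [lia|].
        rewrite Cmult_0_r, Cmod_0. ring. }
    rewrite <- Hca.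
    apply Rle_trans with (rowabs c M l + Cmod beta * rowabs w M l).
    + unfold rowabs. rewrite scal_sum, <- plus_sum. apply sum_Rle. intros n _.
      replace (a l n * (c n + beta * w n))%C with (a l n * c n + a l n * w n * beta)%C by ring.
      rewrite <- Cmod_mult. apply Cmod_triangle.
    + apply Rplus_le_compat_l. specialize (Hwa l Hl).
      apply Rle_trans with (Cmod beta * ((/ 2) ^ t / (1 + Cmod beta))).
      * apply Rmult_le_compat_l; assumption.
      * replace ((/ 2) ^ t) with ((1 + Cmod beta) * ((/ 2) ^ t / (1 + Cmod beta))) at 2
          by (field; lra).
        apply Rmult_le_compat_r; [|lra]. left; apply Rdiv_lt_0_compat; lra.
Qed.

(** The stages stabilise to one coefficient sequence. Row [l] is exact at every cut-off of a stage
    after [l], and its absolute partial sums are bounded; absolute convergence then forces the full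
    sum to be [b l]. *)
Lemma polya_system :
  exists c : nat -> C, forall l, Cseries_abs_sum (fun n => a l n * c n)%C (b l).
Proof.
  set (step := fun t st => proj1_sig (constructive_indefinite_description _ (extends_ex t st))).
  assert (Hstep : forall t st, extends t st (step t st))
    by (intros t st; exact (proj2_sig (constructive_indefinite_description _ (extends_ex t st)))).
  set (st := fix st t := match t with O => (O, fun _ => RtoC 0) | S t => step t (st t) end).
  assert (Hst : forall t, extends t (st t) (st (S t))) by (intros t; apply Hstep).
  set (N := fun t => fst (st t)).
  assert (HNmono : forall t t', (t <= t')%nat -> (N t <= N t')%nat).
  { intros t t' H. induction H as [|t' H IH]; [lia|].
    destruct (Hst t') as [H1 _]. unfold N in *. lia. }
  assert (HNge : forall t, (t <= N t)%nat).
  { induction t as [|t IH]; [lia|]. destruct (Hst t) as [H1 _]. unfold N in *. lia. }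
  assert (Hagree : forall t t' n, (t <= t')%nat -> (n <= N t)%nat -> snd (st t') n = snd (st t) n).
  { intros t t' n H Hn. induction H as [|t' H IH]; [reflexivity|].
    destruct (Hst t') as (_ & H1 & _). rewrite H1; [exact IH|].
    specialize (HNmono t t' H). unfold N in *. lia. }
  (* The diagonal is the common limit: entries up to [N t] are frozen from stage [t] on, and
     [n <= N n]. *)
  set (c := fun n => snd (st n) n).
  assert (Hc : forall t n, (n <= N t)%nat -> c n = snd (st t) n).
  { intros t n Hn. unfold c. destruct (Nat.le_gt_cases t n) as [H|H].
    - now apply Hagree.
    - symmetry. apply Hagree; [lia|]. apply HNge. }
  assert (Hrow : forall t l, (l < t)%nat -> row c (N t) l = b l).
  { intros t l Hl. transitivity (row (snd (st t)) (N t) l).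
    - apply Cpsum_ext. intros n Hn. now rewrite (Hc t n Hn).
    - induction Hl as [|t Hl IH].
      + apply (Hst l).
      + destruct (Hst t) as (_ & _ & H1 & _). unfold N in *. rewrite H1 by lia. exact IH. }
  exists c. intros l.
  set (s := sum_f_R0 (fun n => Cmod (a l n * c n))).
  assert (Hgrow : Un_growing s).
  { intros n. unfold s. simpl. pose proof (Cmod_ge_0 (a l (S n) * c (S n))). lra. }
  assert (HsN : forall t, s (N t) = rowabs (snd (st t)) (N t) l).
  { intros t. apply sum_eq. intros n Hn. now rewrite (Hc t n Hn). }
  (* Only the stages after [l] count. Each increment is at most [(/ 2) ^ q], and [2 - 2 * (/ 2) ^ q]
     is the geometric partial sum. *)
  assert (Hbound : forall q, s (N (S l + q)%nat) <= s (N (S l)) + 2 - 2 * (/ 2) ^ q).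
  { induction q as [|q IH].
    - rewrite Nat.add_0_r. simpl. lra.
    - rewrite Nat.add_succ_r. destruct (Hst (S l + q)%nat) as (_ & _ & _ & _ & H1).
      specialize (H1 l ltac:(lia)). fold (N (S (S l + q))) (N (S l + q)%nat) in H1.
      rewrite <- !HsN in H1.
      assert ((/ 2) ^ (S l + q) <= (/ 2) ^ q).
      { rewrite pow_add. rewrite <- (Rmult_1_l ((/ 2) ^ q)) at 2.
        apply Rmult_le_compat_r; [apply pow_le; lra|].
        rewrite <- (pow1 (S l)). apply pow_incr. lra. }
      change ((/ 2) ^ S q) with (/ 2 * (/ 2) ^ q). lra. }
  assert (Hub : has_ub s).
  { exists (s (N (S l)) + 2). intros x [n ->].
    apply Rle_trans with (s (N (S l + n)%nat)).
    - apply Rge_le, growing_prop; [exact Hgrow|]. specialize (HNge (S l + n)%nat). lia.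
    - eapply Rle_trans; [apply Hbound|]. assert (0 < (/ 2) ^ n) by (apply pow_lt; lra). lra. }
  destruct (growing_cv s Hgrow Hub) as [L HL].
  split.
  - exists L. intros eps He. destruct (HL eps He) as [n0 Hn0]. exists n0. intros n Hn.
    specialize (Hn0 n Hn). unfold s in Hn0.
    rewrite (sum_eq _ (fun n => Cmod (a l n * c n))); [exact Hn0|].
    intros; apply Cnorm_Cmod.
  - intros eps He. destruct (HL eps He) as [n0 Hn0].
    (* At this cut-off the partial sum equals [b l] exactly, so the error at [n] is bounded by a
       tail of the absolute series. *)
    exists (N (S l + n0)%nat). intros n Hn. rewrite Cnorm_Cmod.
    change (Csub (Cpsum (fun n => a l n * c n)%C n) (b l)) with (row c n l - b l)%C.
    rewrite <- (Hrow (S l + n0)%nat l) by lia.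
    eapply Rle_lt_trans; [apply Cpsum_diff_le; exact Hn|].
    assert (H1 := growing_ineq s L Hgrow HL n).
    specialize (Hn0 (N (S l + n0)%nat)). specialize (HNge (S l + n0)%nat).
    specialize (Hn0 ltac:(lia)). unfold Rdist in Hn0.
    apply Rabs_def2 in Hn0. change (s n - s (N (S l + n0)%nat) < eps). lra.
Qed.
End Polya.

(** * Complex exponentials and series *)

Lemma exp_le x y : x <= y -> exp x <= exp y.
Proof. intros [H| ->]; [left; now apply exp_increasing|apply Rle_refl]. Qed.

(** Common source of the elementary estimates that follow: a remainder is controlled by its
    derivative at a point of no larger absolute value, where a simpler estimate is available. *)
Lemma mvt_zero (f df : R -> R) x : (forall y, is_derive f y (df y)) ->
  exists c, Rabs c <= Rabs x /\ f x - f 0 = df c * x.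
Proof.
  intros Hf. destruct (MVT_gen f 0 x df) as (c & Hc & E).
  - intros; apply Hf.
  - intros y _. apply continuity_pt_filterlim, (ex_derive_continuous f). exists (df y). apply Hf.
  - exists c. split; [|rewrite E; ring].
    revert Hc. unfold Rmin, Rmax, Rabs.
    destruct (Rle_dec 0 x), (Rcase_abs c), (Rcase_abs x); lra.
Qed.

Lemma Rabs_sin_le x : Rabs (sin x) <= Rabs x.
Proof.
  destruct (mvt_zero sin cos x) as (c & _ & E); [intros; auto_derive; [trivial|ring]|].
  rewrite sin_0, Rminus_0_r in E. rewrite E, Rabs_mult.
  pose proof (Rabs_pos x). assert (Rabs (cos c) <= 1) by (apply Rabs_le, COS_bound). nra.
Qed.

Lemma Rabs_cos_1_le x : Rabs (cos x - 1) <= Rabs x /\ Rabs (cos x - 1) <= Rabs x * Rabs x.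
Proof.
  destruct (mvt_zero cos (fun y => - sin y) x) as (c & Hc & E); [intros; auto_derive; [trivial|ring]|].
  rewrite cos_0 in E. rewrite E, Rabs_mult, Rabs_Ropp.
  pose proof (Rabs_pos x). assert (Rabs (sin c) <= 1) by (apply Rabs_le, SIN_bound).
  pose proof (Rabs_sin_le c). split; nra.
Qed.

Lemma Rabs_sin_id_le x : Rabs (sin x - x) <= Rabs x * Rabs x.
Proof.
  destruct (mvt_zero (fun y => sin y - y) (fun y => cos y - 1) x) as (c & Hc & E);
    [intros; auto_derive; [trivial|ring]|].
  rewrite sin_0, !Rminus_0_r in E. rewrite E, Rabs_mult.
  pose proof (Rabs_pos x). pose proof (proj1 (Rabs_cos_1_le c)). nra.
Qed.

Lemma Rabs_exp_1_le x : Rabs (exp x - 1) <= Rabs x * exp (Rabs x).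
Proof.
  destruct (mvt_zero exp exp x) as (c & Hc & E); [intros; auto_derive; [trivial|ring]|].
  rewrite exp_0 in E. rewrite E, Rabs_mult, (Rabs_pos_eq (exp c)) by (left; apply exp_pos).
  rewrite Rmult_comm. apply Rmult_le_compat_l; [apply Rabs_pos|].
  apply exp_le. pose proof (Rle_abs c). lra.
Qed.

Lemma Rabs_exp_1_id_le x : Rabs (exp x - 1 - x) <= Rabs x * Rabs x * exp (Rabs x).
Proof.
  destruct (mvt_zero (fun y => exp y - 1 - y) (fun y => exp y - 1) x) as (c & Hc & E);
    [intros; auto_derive; [trivial|ring]|].
  rewrite exp_0 in E. replace (exp x - 1 - x) with ((exp c - 1) * x) by lra.
  rewrite Rabs_mult. pose proof (Rabs_exp_1_le c) as H.
  pose proof (Rabs_pos x). pose proof (Rabs_pos c).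
  assert (exp (Rabs c) <= exp (Rabs x)) by (apply exp_le; exact Hc).
  pose proof (exp_pos (Rabs c)).
  assert (Rabs c * exp (Rabs c) <= Rabs x * exp (Rabs x)) by (apply Rmult_le_compat; lra).
  nra.
Qed.

Lemma Cmod_le_abs (z : C) : Cmod z <= Rabs (fst z) + Rabs (snd z).
Proof.
  destruct z as [x y]; simpl.
  replace (x, y) with (RtoC x + Ci * RtoC y)%C
    by (unfold RtoC, Ci, Cplus, Cmult; simpl; f_equal; ring).
  eapply Rle_trans; [apply Cmod_triangle|].
  rewrite Cmod_mult, Cmod_Ci, !Cmod_R. lra.
Qed.

Lemma abs_le_Cmod (z : C) : Rabs (fst z) <= Cmod z /\ Rabs (snd z) <= Cmod z.
Proof.
  pose proof (Rmax_Cmod z) as H.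
  pose proof (Rmax_l (Rabs (fst z)) (Rabs (snd z))).
  pose proof (Rmax_r (Rabs (fst z)) (Rabs (snd z))). split; lra.
Qed.

Lemma Cmod_Cexp (z : C) : Cmod (Cexp z) = exp (fst z).
Proof.
  rewrite <- Cnorm_Cmod. unfold Cnorm, Cexp; simpl.
  replace (_ + _) with (exp (fst z) * exp (fst z) * (Rsqr (sin (snd z)) + Rsqr (cos (snd z))))
    by (unfold Rsqr; ring).
  rewrite sin2_cos2, Rmult_1_r. apply sqrt_square. left; apply exp_pos.
Qed.

Lemma Cexp_plus (z w : C) : Cexp (z + w)%C = (Cexp z * Cexp w)%C.
Proof.
  unfold Cexp, Cplus, Cmult; simpl. rewrite exp_plus, cos_plus, sin_plus. f_equal; ring.
Qed.

Lemma Cexp_taylor (z : C) :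
  Cmod (Cexp z - 1 - z) <= 4 * (Cmod z * Cmod z * exp (Cmod z)).
Proof.
  destruct (abs_le_Cmod z) as [Hx Hy]. eapply Rle_trans; [apply Cmod_le_abs|].
  set (T := Cmod z) in *. destruct z as [x y].
  unfold Cexp, Cminus, Cplus, Copp, RtoC; simpl in *.
  (* The real and imaginary parts are split into four pieces, each of second order and at most
     [T * T * exp T]; this is the origin of the factor 4. *)
  replace (exp x * cos y + - (1) + - x) with ((exp x - 1 - x) + exp x * (cos y - 1)) by ring.
  replace (exp x * sin y + - 0 + - y) with (exp x * (sin y - y) + (exp x - 1) * y) by ring.
  pose proof (Rabs_triang (exp x - 1 - x) (exp x * (cos y - 1))) as T1.
  pose proof (Rabs_triang (exp x * (sin y - y)) ((exp x - 1) * y)) as T2.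
  rewrite !Rabs_mult, (Rabs_pos_eq (exp x)) in * by (left; apply exp_pos).
  pose proof (Rabs_exp_1_id_le x). pose proof (Rabs_exp_1_le x).
  pose proof (proj2 (Rabs_cos_1_le y)). pose proof (Rabs_sin_id_le y).
  assert (E1 : exp (Rabs x) <= exp T) by (apply exp_le; exact Hx).
  assert (E2 : exp x <= exp T) by (apply exp_le; pose proof (Rle_abs x); lra).
  pose proof (exp_pos x). pose proof (exp_pos (Rabs x)).
  pose proof (Rabs_pos x). pose proof (Rabs_pos y).
  assert (Sx : Rabs x * Rabs x <= T * T) by (apply Rmult_le_compat; lra).
  assert (Sy : Rabs y * Rabs y <= T * T) by (apply Rmult_le_compat; lra).
  assert (A1 : Rabs (exp x - 1 - x) <= T * T * exp T).
  { eapply Rle_trans; [eassumption|]. apply Rmult_le_compat; nra. }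
  assert (A2 : exp x * Rabs (cos y - 1) <= T * T * exp T).
  { rewrite (Rmult_comm (T * T)). apply Rmult_le_compat; try lra. apply Rabs_pos. }
  assert (A3 : exp x * Rabs (sin y - y) <= T * T * exp T).
  { rewrite (Rmult_comm (T * T)). apply Rmult_le_compat; try lra. apply Rabs_pos. }
  assert (A4 : Rabs (exp x - 1) * Rabs y <= T * T * exp T).
  { replace (T * T * exp T) with (T * exp T * T) by ring.
    apply Rmult_le_compat; try apply Rabs_pos; try lra.
    eapply Rle_trans; [eassumption|]. apply Rmult_le_compat; lra. }
  lra.
Qed.

(** * Absolutely convergent complex series *)

Definition Csum (a : nat -> C) : C := (Series (fun n => fst (a n)), Series (fun n => snd (a n))).

Lemma ex_series_components (a : nat -> C) : ex_series (fun n => Cmod (a n)) ->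
  ex_series (fun n => Rabs (fst (a n))) /\ ex_series (fun n => Rabs (snd (a n))).
Proof.
  intros H.
  split; (apply (ex_series_le (V := R_CompleteNormedModule)) with (fun n => Cmod (a n)); [|exact H]);
    intros n; change norm with Rabs; simpl; rewrite Rabs_Rabsolu; apply abs_le_Cmod.
Qed.

Lemma Cpsum_components (a : nat -> C) N :
  Cpsum a N = (sum_f_R0 (fun n => fst (a n)) N, sum_f_R0 (fun n => snd (a n)) N).
Proof.
  induction N as [|N IH]; simpl; [apply surjective_pairing|].
  rewrite IH. reflexivity.
Qed.

Lemma Series_Un_cv (f : nat -> R) : ex_series f -> Un_cv (sum_f_R0 f) (Series f).
Proof.
  intros H. apply Series_correct, is_series_Reals in H. exact H.
Qed.

Lemma Csum_correct (a : nat -> C) : ex_series (fun n => Cmod (a n)) -> Cseries_abs_sum a (Csum a).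
Proof.
  intros H. destruct (ex_series_components a H) as [H1 H2]. split.
  - exists (Series (fun n => Cnorm (a n))). apply Series_Un_cv.
    eapply ex_series_ext; [|exact H]. intros n. simpl. now rewrite Cnorm_Cmod.
  - apply ex_series_Rabs, Series_Un_cv in H1. apply ex_series_Rabs, Series_Un_cv in H2.
    intros eps He. destruct (H1 (eps / 2)) as [N1 HN1]; [lra|].
    destruct (H2 (eps / 2)) as [N2 HN2]; [lra|].
    exists (N1 + N2)%nat. intros n Hn. rewrite Cnorm_Cmod.
    eapply Rle_lt_trans; [apply Cmod_le_abs|]. rewrite Cpsum_components; simpl.
    specialize (HN1 n ltac:(lia)). specialize (HN2 n ltac:(lia)). unfold Rdist in *. lra.
Qed.

Lemma Cseries_abs_sum_ex_series (a : nat -> C) S :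
  Cseries_abs_sum a S -> ex_series (fun n => Cmod (a n)).
Proof.
  intros [[l Hl] _]. apply ex_series_ext with (fun n => Cnorm (a n)).
  - intros n. apply Cnorm_Cmod.
  - exists l. apply is_series_Reals. exact Hl.
Qed.

Lemma Cseries_abs_sum_unique (a : nat -> C) (S T : C) :
  Cseries_abs_sum a S -> Cseries_abs_sum a T -> S = T.
Proof.
  intros [_ HS] [_ HT].
  assert (E : Cmod (S - T) = 0).
  { apply Rle_antisym; [|apply Cmod_ge_0]. apply le_epsilon. intros eps He.
    destruct (HS (eps / 2)) as [N1 HN1]; [lra|]. destruct (HT (eps / 2)) as [N2 HN2]; [lra|].
    specialize (HN1 (N1 + N2)%nat ltac:(lia)). specialize (HN2 (N1 + N2)%nat ltac:(lia)).
    rewrite Cnorm_Cmod in HN1, HN2. set (p := Cpsum a (N1 + N2)) in *.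
    change (Csub p S) with (Cminus p S) in HN1. change (Csub p T) with (Cminus p T) in HN2.
    replace (S - T)%C with ((p - T) + - (p - S))%C by ring.
    pose proof (Cmod_triangle (p - T) (- (p - S))) as Ht. rewrite Cmod_opp in Ht. lra. }
  apply Cmod_eq_0 in E. replace S with ((S - T) + T)%C by ring. rewrite E. ring.
Qed.

(** Real and imaginary parts are estimated separately, which costs the harmless factor 2. *)
Lemma Csum_Cmod_le (a : nat -> C) : ex_series (fun n => Cmod (a n)) ->
  Cmod (Csum a) <= 2 * Series (fun n => Cmod (a n)).
Proof.
  intros H. destruct (ex_series_components a H) as [H1 H2].
  eapply Rle_trans; [apply Cmod_le_abs|]. unfold Csum; simpl.
  apply Series_Rabs in H1. apply Series_Rabs in H2.
  assert (Series (fun n => Rabs (fst (a n))) <= Series (fun n => Cmod (a n))).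
  { apply Series_le; [|exact H]. intros n. split; [apply Rabs_pos|apply abs_le_Cmod]. }
  assert (Series (fun n => Rabs (snd (a n))) <= Series (fun n => Cmod (a n))).
  { apply Series_le; [|exact H]. intros n. split; [apply Rabs_pos|apply abs_le_Cmod]. }
  lra.
Qed.

Lemma Csum_minus (a b : nat -> C) :
  ex_series (fun n => Cmod (a n)) -> ex_series (fun n => Cmod (b n)) ->
  Csum (fun n => a n - b n)%C = (Csum a - Csum b)%C.
Proof.
  intros Ha Hb.
  destruct (ex_series_components a Ha) as [A1 A2]. destruct (ex_series_components b Hb) as [B1 B2].
  unfold Csum, Cminus, Cplus, Copp; simpl.
  f_equal; apply Series_minus; apply ex_series_Rabs; assumption.
Qed.

Lemma Csum_scal (k : C) (a : nat -> C) : ex_series (fun n => Cmod (a n)) ->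
  Csum (fun n => k * a n)%C = (k * Csum a)%C.
Proof.
  intros Ha. destruct (ex_series_components a Ha) as [A1 A2].
  apply ex_series_Rabs in A1. apply ex_series_Rabs in A2.
  unfold Csum, Cmult; simpl. rewrite <- !Series_scal_l.
  f_equal.
  - apply Series_minus; apply (ex_series_scal_l (V := R_NormedModule)); assumption.
  - apply Series_plus; apply (ex_series_scal_l (V := R_NormedModule)); assumption.
Qed.

(** * Powers against exponentials, finite bounds and subsequences *)

Lemma pow_exp_bounded j eta : 0 < eta ->
  exists B, 0 < B /\ forall x, 0 <= x -> x ^ j * exp (- eta * x) <= B.
Proof.
  revert eta. induction j as [|j IH]; intros eta He.
  - exists 1. split; [lra|]. intros x Hx. simpl. rewrite Rmult_1_l, <- exp_0.
    apply exp_le. nra.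
  - destruct (IH (eta / 2)) as (B & HB & H); [lra|].
    exists (B * (2 / eta)). split; [apply Rmult_lt_0_compat; [lra|apply Rdiv_lt_0_compat; lra]|].
    intros x Hx.
    (* Half of the exponent absorbs [x ^ j] by induction; the other half absorbs the extra factor
       [x], through [1 + y <= exp y]. *)
    replace (- eta * x) with (- (eta / 2) * x + - (eta / 2) * x) by field.
    rewrite exp_plus. simpl.
    replace (x * x ^ j * (exp (- (eta / 2) * x) * exp (- (eta / 2) * x)))
      with ((x ^ j * exp (- (eta / 2) * x)) * (x * exp (- (eta / 2) * x))) by ring.
    pose proof (exp_pos (- (eta / 2) * x)).
    apply Rmult_le_compat.
    + apply Rmult_le_pos; [apply pow_le; exact Hx|lra].
    + apply Rmult_le_pos; lra.
    + apply H; exact Hx.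
    + pose proof (exp_ineq1_le (eta / 2 * x)).
      assert (E : exp (- (eta / 2) * x) * exp (eta / 2 * x) = 1).
      { rewrite <- exp_plus, <- exp_0. f_equal. ring. }
      assert (exp (- (eta / 2) * x) * (eta / 2 * x) <= 1) by (rewrite <- E; apply Rmult_le_compat_l; lra).
      apply Rmult_le_reg_l with (eta / 2); [lra|]. replace (eta / 2 * (2 / eta)) with 1 by (field; lra).
      lra.
Qed.

Lemma finite_bound (f : nat -> R) N : exists B, 0 < B /\ forall n, (n < N)%nat -> f n <= B.
Proof.
  induction N as [|N (B & HB & H)].
  - exists 1. split; [lra|intros; lia].
  - exists (Rmax B (f N)). split; [pose proof (Rmax_l B (f N)); lra|]. intros n Hn.
    destruct (Nat.eq_dec n N) as [->|]; [apply Rmax_r|].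
    eapply Rle_trans; [apply H; lia|apply Rmax_l].
Qed.

(** Compactness of the interval from -1 to 1. The index map is only asked to satisfy [k <= phi k],
    which already preserves limits. *)
Lemma subsequence_cv (u : nat -> R) : (forall n, Rabs (u n) <= 1) ->
  exists l (phi : nat -> nat), (forall k, (k <= phi k)%nat) /\ Un_cv (fun k => u (phi k)) l.
Proof.
  intros Hu.
  destruct (Bolzano_Weierstrass u (fun c => -1 <= c <= 1) (compact_P3 (-1) 1)) as [l Hl].
  { intros n. apply Rabs_le_between, Hu. }
  assert (H : forall k, exists p, (k <= p)%nat /\ Rabs (u p - l) < / (INR k + 1)).
  { intros k. apply (Hl (fun y => Rabs (y - l) < / (INR k + 1)) k).
    exists (mkposreal _ (RinvN_pos k)). intros y Hy. exact Hy. }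
  apply choice in H. destruct H as [phi H]. exists l, phi.
  split; [intros k; apply H|]. intros eps He.
  destruct (archimed_cor1 eps He) as (N & HN & HN0). exists N. intros n Hn.
  eapply Rlt_trans; [apply (proj2 (H n))|]. eapply Rle_lt_trans; [|exact HN].
  apply Rinv_le_contravar; [now apply lt_0_INR|].
  apply le_INR in Hn. lra.
Qed.

(** * Lacunary frequencies with a unique limit direction *)

Lemma Cscal_RtoC (r : R) (z : C) : Cscal r z = (RtoC r * z)%C.
Proof. unfold Cscal, RtoC, Cmult; simpl. f_equal; ring. Qed.

(** Linear growth is the form in which lacunarity enters the comparison with geometric series. The
    constant comes from [lam 1], as [lam 0] may be zero. *)
Lemma lacunary_linear (lam : nat -> C) : (forall n, Cnorm (lam (S n)) > 2 * Cnorm (lam n)) ->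
  exists rho, 0 < rho /\ forall n, rho * INR n <= Cmod (lam n).
Proof.
  intros H. exists (Cmod (lam 1%nat) / 2).
  assert (H1 : 0 < Cmod (lam 1%nat)).
  { specialize (H 0%nat). rewrite !Cnorm_Cmod in H. pose proof (Cmod_ge_0 (lam 0%nat)). lra. }
  split; [lra|]. intros n. destruct n as [|n].
  - simpl. rewrite Rmult_0_r. apply Cmod_ge_0.
  - induction n as [|n IH]; [simpl; lra|].
    specialize (H (S n)). rewrite !Cnorm_Cmod in H. rewrite S_INR.
    assert (Cmod (lam 1%nat) / 2 * 1 <= Cmod (lam 1%nat) / 2 * INR (S n)).
    { apply Rmult_le_compat_l; [lra|]. rewrite S_INR. pose proof (pos_INR n). lra. }
    lra.
Qed.

Lemma linear_eventually_large (L : nat -> R) rho : 0 < rho -> (forall n, rho * INR n <= L n) ->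
  forall A, exists N, forall n, (N <= n)%nat -> A < L n.
Proof.
  intros Hr HL A. destruct (INR_unbounded (A / rho)) as [N HN].
  exists N. intros n Hn. eapply Rlt_le_trans; [|apply HL].
  apply le_INR in Hn. apply Rmult_lt_reg_r with (/ rho); [now apply Rinv_0_lt_compat|].
  replace (rho * INR n * / rho) with (INR n) by (field; lra). unfold Rdiv in HN. lra.
Qed.

Lemma Un_cv_subseq (u : nat -> R) l (psi : nat -> nat) :
  Un_cv u l -> (forall k, (k <= psi k)%nat) -> Un_cv (fun k => u (psi k)) l.
Proof.
  intros Hu Hpsi eps He. destruct (Hu eps He) as [N HN]. exists N. intros n Hn.
  apply HN. specialize (Hpsi n). lia.
Qed.

(** Otherwise infinitely many frequencies have directions farther than [eps] from [s]; compactness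
    of the unit circle extracts from them a limit direction [t], which must be [s], a
    contradiction. *)
Lemma unique_limit_direction (Lambda : C -> Prop) (s : C) (lam : nat -> C) rho :
  (forall t, limit_direction Lambda t -> t = s) -> (forall n, Lambda (lam n)) ->
  0 < rho -> (forall n, rho * INR n <= Cmod (lam n)) ->
  forall eps, 0 < eps -> exists N, forall n, (N <= n)%nat ->
    Cmod (lam n - RtoC (Cmod (lam n)) * s) <= eps * Cmod (lam n).
Proof.
  intros HP HL Hrho Hlin eps He. apply NNPP. intros Hno.
  destruct (linear_eventually_large (fun n => Cmod (lam n)) rho Hrho Hlin 0) as [N0 HN0].
  assert (Hbad : forall k, exists n, (k <= n)%nat /\ 0 < Cmod (lam n) /\
    eps * Cmod (lam n) < Cmod (lam n - RtoC (Cmod (lam n)) * s)).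
  { intros k. apply NNPP. intros Hk. apply Hno. exists (k + N0)%nat. intros n Hn.
    apply Rnot_lt_le. intros Hlt. apply Hk. exists n.
    split; [lia|]. split; [apply HN0; lia|exact Hlt]. }
  apply choice in Hbad. destruct Hbad as [theta Htheta].
  set (dir := fun k => (RtoC (/ Cmod (lam (theta k))) * lam (theta k))%C).
  assert (Hdir1 : forall k, Cmod (dir k) = 1).
  { intros k. unfold dir. destruct (Htheta k) as (_ & Hp & _).
    rewrite Cmod_mult, Cmod_R, Rabs_pos_eq by (left; now apply Rinv_0_lt_compat). field. lra. }
  assert (Hdirs : forall k, eps < Cmod (dir k - s)).
  { intros k. destruct (Htheta k) as (_ & Hp & Hlt).
    apply Rmult_lt_reg_r with (Cmod (lam (theta k))); [exact Hp|].
    eapply Rlt_le_trans; [exact Hlt|]. right.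
    rewrite <- (Rabs_pos_eq (Cmod (lam (theta k)))) at 2 by (left; exact Hp).
    rewrite <- Cmod_R, <- Cmod_mult. f_equal. unfold dir. rewrite RtoC_inv by lra. field.
    intros E. apply RtoC_inj in E. lra. }
  (* Two successive extractions, for the real parts and then for the imaginary parts. *)
  destruct (subsequence_cv (fun k => fst (dir k))) as (l1 & phi & Hphi & Hl1).
  { intros k. rewrite <- (Hdir1 k). apply abs_le_Cmod. }
  destruct (subsequence_cv (fun k => snd (dir (phi k)))) as (l2 & psi & Hpsi & Hl2).
  { intros k. rewrite <- (Hdir1 (phi k)). apply abs_le_Cmod. }
  apply (Un_cv_subseq _ _ psi) in Hl1; [|exact Hpsi].
  set (t := (l1, l2) : C).
  assert (Hcv : forall e, 0 < e -> exists K, forall k, (K <= k)%nat ->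
    Cmod (dir (phi (psi k)) - t) < e).
  { intros e Hpe. destruct (Hl1 (e / 2)) as [K1 HK1]; [lra|].
    destruct (Hl2 (e / 2)) as [K2 HK2]; [lra|]. exists (K1 + K2)%nat. intros k Hk.
    specialize (HK1 k ltac:(lia)). specialize (HK2 k ltac:(lia)). unfold Rdist in *.
    eapply Rle_lt_trans; [apply Cmod_le_abs|].
    unfold Rminus in *; cbn -[dir] in *. lra. }
  assert (Ht : limit_direction Lambda t).
  { split; [|exists (fun k => lam (theta (phi (psi k)))); split; [|split]].
    - rewrite Cnorm_Cmod. apply Rle_antisym; apply le_epsilon; intros e Hpe;
        destruct (Hcv e Hpe) as [K HK]; specialize (HK K (le_n K)); set (d := dir _) in *;
        assert (Hd : Cmod d = 1) by apply Hdir1.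
      + replace t with (d + - (d - t))%C by ring.
        pose proof (Cmod_triangle d (- (d - t))) as T. rewrite Cmod_opp in T. lra.
      + pose proof (Cmod_triangle (d - t) t) as T.
        replace ((d - t) + t)%C with d in T by ring. lra.
    - intros k. apply HL.
    - intros A. destruct (linear_eventually_large (fun n => Cmod (lam n)) rho Hrho Hlin A) as [N HN].
      exists N. intros k Hk. rewrite Cnorm_Cmod. apply HN.
      destruct (Htheta (phi (psi k))) as [H1 _].
      specialize (Hphi (psi k)). specialize (Hpsi k). lia.
    - intros e Hpe. destruct (Hcv e Hpe) as [K HK]. exists K. intros k Hk.
      rewrite !Cnorm_Cmod, Cscal_RtoC. apply (HK k Hk). }
  destruct (Hcv eps He) as [K HK]. specialize (HK K (le_n K)).
  rewrite (HP t Ht) in HK. specialize (Hdirs (phi (psi K))). lra.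
Qed.

(** For large [n], [lam n * w] has real part close to [Cmod (lam n)] times that of [s * w], which is
    negative; the remaining indices are absorbed into [B]. *)
Lemma directional_decay (lam : nat -> C) (s : C) :
  (forall eps, 0 < eps -> exists N, forall n, (N <= n)%nat ->
    Cmod (lam n - RtoC (Cmod (lam n)) * s) <= eps * Cmod (lam n)) ->
  forall w : C, fst (s * w)%C < 0 -> exists eta B, 0 < eta /\ 0 < B /\
    forall n, exp (fst (lam n * w)%C) <= B * exp (- eta * Cmod (lam n)).
Proof.
  intros Hdir w Hw. set (d := - fst (s * w)%C). assert (Hd : 0 < d) by (unfold d; lra).
  pose proof (Cmod_ge_0 w) as Hw0.
  (* With this tolerance the angular error costs at most [d / 2] of the rate [d], leaving
     [d / 2]. *)
  destruct (Hdir (d / (2 * (1 + Cmod w)))) as [N HN]; [apply Rdiv_lt_0_compat; lra|].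
  destruct (finite_bound (fun n => exp (fst (lam n * w)%C) * exp (d / 2 * Cmod (lam n))) N)
    as (B & HB & HBn).
  exists (d / 2), (B + 1). split; [lra|]. split; [lra|]. intros n.
  pose proof (exp_pos (- (d / 2) * Cmod (lam n))).
  destruct (Nat.lt_ge_cases n N) as [Hn|Hn].
  - specialize (HBn n Hn). cbv beta in HBn.
    replace (exp (fst (lam n * w)%C)) with
      (exp (fst (lam n * w)%C) * exp (d / 2 * Cmod (lam n)) * exp (- (d / 2) * Cmod (lam n))).
    + apply Rmult_le_compat_r; lra.
    + rewrite Rmult_assoc, <- exp_plus.
      replace (d / 2 * Cmod (lam n) + - (d / 2) * Cmod (lam n)) with 0 by ring.
      rewrite exp_0. ring.
  - apply Rle_trans with (1 * exp (- (d / 2) * Cmod (lam n))); [|apply Rmult_le_compat_r; lra].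
    rewrite Rmult_1_l. apply exp_le. specialize (HN n Hn).
    set (L := Cmod (lam n)) in *. assert (HL : 0 <= L) by apply Cmod_ge_0.
    assert (E : fst (lam n * w)%C = fst ((lam n - RtoC L * s) * w)%C - L * d).
    { unfold d, Cminus, Cplus, Cmult, Copp, RtoC; simpl. ring. }
    rewrite E.
    assert (fst ((lam n - RtoC L * s) * w)%C <= d / 2 * L); [|lra].
    eapply Rle_trans; [apply Rle_abs|]. eapply Rle_trans; [apply abs_le_Cmod|].
    rewrite Cmod_mult.
    apply Rle_trans with (d / (2 * (1 + Cmod w)) * L * (1 + Cmod w)).
    + apply Rmult_le_compat; try apply Cmod_ge_0; lra.
    + right. field. lra.
Qed.

Lemma term_le_Series (f : nat -> R) n : (forall k, 0 <= f k) -> ex_series f -> f n <= Series f.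
Proof.
  intros Hf H. apply Rle_trans with (sum_f_R0 f n).
  - destruct n as [|n]; simpl; [lra|]. pose proof (cond_pos_sum f n Hf). lra.
  - apply growing_ineq; [|now apply Series_Un_cv]. intros k. simpl. specialize (Hf (S k)). lra.
Qed.

(** * Exponential series: convergence and growth to the left of a node *)

Section Exponentials.
Variables (s : C) (lam : nat -> C) (rho : R).
Hypothesis rho_pos : 0 < rho.
Hypothesis lam_linear : forall n, rho * INR n <= Cmod (lam n).
Hypothesis lam_decay : forall w : C, fst (s * w)%C < 0 -> exists eta B, 0 < eta /\ 0 < B /\
  forall n, exp (fst (lam n * w)%C) <= B * exp (- eta * Cmod (lam n)).

(** Half of the exponential absorbs the power; by linear growth of the frequencies the other half is
    dominated by a geometric sequence of ratio [exp (- (eta / 2) * rho)]. *)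
Lemma ex_series_pow_exp j eta : 0 < eta ->
  ex_series (fun n => Cmod (lam n) ^ j * exp (- eta * Cmod (lam n))).
Proof.
  intros He. destruct (pow_exp_bounded j (eta / 2)) as (B & HB & H); [lra|].
  set (q := exp (- (eta / 2) * rho)).
  assert (Hq : 0 < q < 1).
  { split; [apply exp_pos|]. unfold q. rewrite <- exp_0. apply exp_increasing. nra. }
  assert (Hqn : forall n, q ^ n = exp (- (eta / 2) * (rho * INR n))).
  { induction n as [|n IH]; [simpl; rewrite !Rmult_0_r, exp_0; reflexivity|].
    rewrite S_INR. simpl. rewrite IH. unfold q. rewrite <- exp_plus. f_equal. ring. }
  apply (ex_series_le (V := R_CompleteNormedModule)) with (fun n => B * q ^ n).
  - intros n. change norm with Rabs; simpl. pose proof (Cmod_ge_0 (lam n)).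
    rewrite Rabs_pos_eq by (apply Rmult_le_pos; [apply pow_le; assumption|left; apply exp_pos]).
    replace (- eta * Cmod (lam n)) with (- (eta / 2) * Cmod (lam n) + - (eta / 2) * Cmod (lam n)) by field.
    rewrite exp_plus, <- Rmult_assoc. apply Rmult_le_compat.
    + apply Rmult_le_pos; [apply pow_le; assumption|left; apply exp_pos].
    + left; apply exp_pos.
    + apply H. assumption.
    + rewrite Hqn. apply exp_le. specialize (lam_linear n). nra.
  - apply (ex_series_scal_l (V := R_NormedModule)), ex_series_geom. rewrite Rabs_pos_eq; lra.
Qed.

Lemma solution_terms_bounded (c : nat -> C) (z S : C) :
  Cseries_abs_sum (fun n => c n * Cexp (lam n * z))%C S ->
  exists B, 0 < B /\ forall n, Cmod (c n) * exp (fst (lam n * z)%C) <= B.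
Proof.
  intros H. apply Cseries_abs_sum_ex_series in H.
  set (f := fun n => Cmod (c n * Cexp (lam n * z))%C) in H.
  assert (Hf : forall n, 0 <= f n) by (intros n; apply Cmod_ge_0).
  exists (Series f + 1). split.
  - pose proof (term_le_Series f 0 Hf H). specialize (Hf 0%nat). lra.
  - intros n. rewrite <- Cmod_Cexp, <- Cmod_mult. pose proof (term_le_Series f n Hf H).
    unfold f in *. lra.
Qed.

Lemma solution_terms_shift (c : nat -> C) (z w : C) B :
  (forall n, Cmod (c n) * exp (fst (lam n * z)%C) <= B) ->
  forall n, Cmod (c n) * exp (fst (lam n * w)%C) <= B * exp (fst (lam n * (w - z))%C).
Proof.
  intros H n.
  replace (fst (lam n * w)%C) with (fst (lam n * z)%C + fst (lam n * (w - z))%C)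
    by (unfold Cmult, Cminus, Cplus, Copp; simpl; ring).
  rewrite exp_plus, <- Rmult_assoc. apply Rmult_le_compat_r; [left; apply exp_pos|apply H].
Qed.

(* The growth of [U] at the nodes to the left of [mu p] is controlled by a function that does
   not depend on the series, so data growing faster cannot be interpolated. *)
Lemma soluble_nodes_drift (mu : nat -> C) (m : nat -> nat) :
  (forall k, (1 <= m k)%nat) -> interpolation_soluble lam mu m ->
  forall p, exists K, forall k, (K <= k)%nat -> fst (s * mu p)%C <= fst (s * mu k)%C.
Proof.
  intros Hm Hsol p. apply NNPP. intros Hno.
  set (G := fun k => Series (fun n => exp (fst (lam n * (mu k - mu p))%C))).
  (* At a node left of [mu p] the sum is at most [2 * (B * G k)] for a single [B], which these data
     exceed once [INR k > B]. Elsewhere [G k] may be a default value, so [Rabs] keeps the second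
     factor positive. *)
  destruct (Hsol (fun k _ => RtoC (INR k * (1 + 2 * Rabs (G k))))) as (c & U & Hconv & Hval).
  assert (Hat : forall k, Cseries_abs_sum (fun n => c n * Cexp (lam n * mu k))%C (U (mu k))).
  { intros k. destruct (Hconv k) as (r & Hr & H). apply H. rewrite Cnorm_Cmod.
    change (Csub (mu k) (mu k)) with (mu k - mu k)%C.
    replace (mu k - mu k)%C with (RtoC 0) by ring. rewrite Cmod_0. exact Hr. }
  destruct (solution_terms_bounded c (mu p) _ (Hat p)) as (B & HB & HBn).
  destruct (INR_unbounded B) as [K HK].
  apply Hno. exists K. intros k Hk. apply Rnot_lt_le. intros Hlt.
  destruct (lam_decay (mu k - mu p)%C) as (eta & B' & Heta & HB' & Hdec).
  { unfold Cmult, Cminus, Cplus, Copp in *; simpl in *. lra. }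
  assert (HG : ex_series (fun n => exp (fst (lam n * (mu k - mu p))%C))).
  { apply (ex_series_le (V := R_CompleteNormedModule))
      with (fun n => B' * (Cmod (lam n) ^ 0 * exp (- eta * Cmod (lam n)))).
    - intros n. change norm with Rabs; simpl. rewrite Rmult_1_l.
      rewrite Rabs_pos_eq by (left; apply exp_pos). apply Hdec.
    - apply (ex_series_scal_l (V := R_NormedModule)), ex_series_pow_exp. exact Heta. }
  assert (HU : Cmod (U (mu k)) <= 2 * (B * G k)).
  { specialize (Hat k). assert (He := Cseries_abs_sum_ex_series _ _ Hat).
    rewrite (Cseries_abs_sum_unique _ _ _ Hat (Csum_correct _ He)).
    eapply Rle_trans; [apply Csum_Cmod_le; exact He|].
    apply Rmult_le_compat_l; [lra|]. unfold G. rewrite <- Series_scal_l.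
    apply Series_le; [|apply (ex_series_scal_l (V := R_NormedModule)); exact HG].
    intros n. split; [apply Cmod_ge_0|]. rewrite Cmod_mult, Cmod_Cexp.
    apply solution_terms_shift. exact HBn. }
  specialize (Hval k 0%nat (Hm k)). simpl in Hval. rewrite Hval, Cmod_R in HU.
  rewrite Rabs_mult, (Rabs_pos_eq (INR k)) in HU by apply pos_INR.
  rewrite (Rabs_pos_eq (1 + _)) in HU by (pose proof (Rabs_pos (G k)); lra).
  pose proof (Rle_abs (G k)). pose proof (Rabs_pos (G k)).
  apply le_INR in Hk.
  assert (B * G k <= B * Rabs (G k)) by (apply Rmult_le_compat_l; lra).
  assert (B * (1 + 2 * Rabs (G k)) < INR k * (1 + 2 * Rabs (G k)))
    by (apply Rmult_lt_compat_r; lra).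
  lra.
Qed.

(** * Termwise differentiation *)

(** The [j]-th derivative in [z] of the [n]-th term of the exponential series. *)
Definition term (c : nat -> C) (j : nat) (z : C) (n : nat) : C :=
  (c n * (lam n ^ j * Cexp (lam n * z)))%C.

(** Holds strictly to the left of any point of convergence, survives small displacements, and leaves
    room for every power of [lam n]. *)
Definition fast_decay (c : nat -> C) (eta B : R) (z : C) : Prop :=
  forall n, Cmod (c n) * exp (fst (lam n * z)%C) <= B * exp (- eta * Cmod (lam n)).

Lemma Cmod_term c j z n :
  Cmod (term c j z n) = Cmod (lam n) ^ j * (Cmod (c n) * exp (fst (lam n * z)%C)).
Proof. unfold term. rewrite !Cmod_mult, Cmod_pow, Cmod_Cexp. ring. Qed.

(** The bound is explicit and linear in [k], so that [k] can carry the square of the increment in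
    the differentiation argument. *)
Lemma ex_series_dominated c eta B z j (f : nat -> C) k : 0 < eta -> fast_decay c eta B z ->
  (forall n, Cmod (f n) <= k * (Cmod (lam n) ^ j * (B * exp (- eta * Cmod (lam n))))) ->
  ex_series (fun n => Cmod (f n)) /\
  Series (fun n => Cmod (f n)) <=
    k * (B * Series (fun n => Cmod (lam n) ^ j * exp (- eta * Cmod (lam n)))).
Proof.
  intros He Hc Hf.
  assert (H : ex_series (fun n => k * (B * (Cmod (lam n) ^ j * exp (- eta * Cmod (lam n)))))).
  { do 2 apply (ex_series_scal_l (V := R_NormedModule)). now apply ex_series_pow_exp. }
  assert (Hf' : forall n, 0 <= Cmod (f n) <=
    k * (B * (Cmod (lam n) ^ j * exp (- eta * Cmod (lam n))))).
  { intros n. split; [apply Cmod_ge_0|]. specialize (Hf n). lra. }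
  split.
  - apply (ex_series_le (V := R_CompleteNormedModule)) with (2 := H).
    intros n. change norm with Rabs. simpl. rewrite Rabs_pos_eq by apply Hf'. apply Hf'.
  - rewrite <- !Series_scal_l. now apply Series_le.
Qed.

Lemma ex_series_term c eta B z j : 0 < eta -> fast_decay c eta B z ->
  ex_series (fun n => Cmod (term c j z n)).
Proof.
  intros He Hc. apply (ex_series_dominated c eta B z j _ 1 He Hc). intros n.
  rewrite Cmod_term, Rmult_1_l. apply Rmult_le_compat_l; [|apply Hc].
  apply pow_le, Cmod_ge_0.
Qed.

(** The displacement costs a factor at most [exp (eta / 2 * Cmod (lam n))], that is, half of the
    rate. *)
Lemma fast_decay_near c eta B z h : Cmod h <= eta / 2 ->
  fast_decay c eta B z -> fast_decay c (eta / 2) B (z + h)%C.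
Proof.
  intros Hh Hc n. specialize (Hc n).
  replace (fst (lam n * (z + h))%C) with (fst (lam n * z)%C + fst (lam n * h)%C)
    by (unfold Cmult, Cplus; simpl; ring).
  rewrite exp_plus, <- Rmult_assoc.
  apply Rle_trans with (B * exp (- eta * Cmod (lam n)) * exp (eta / 2 * Cmod (lam n))).
  - apply Rmult_le_compat; [|left; apply exp_pos|exact Hc|].
    + apply Rmult_le_pos; [apply Cmod_ge_0|left; apply exp_pos].
    + apply exp_le. eapply Rle_trans; [apply Rle_abs|].
      eapply Rle_trans; [apply abs_le_Cmod|]. rewrite Cmod_mult, Rmult_comm.
      apply Rmult_le_compat_r; [apply Cmod_ge_0|exact Hh].
  - rewrite Rmult_assoc, <- exp_plus. right. do 2 f_equal. field.
Qed.

Lemma term_increment c j w h n :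
  (term c j (w + h) n - term c j w n - h * term c (S j) w n =
   term c j w n * (Cexp (lam n * h) - 1 - lam n * h))%C.
Proof.
  unfold term. replace (lam n * (w + h))%C with (lam n * w + lam n * h)%C by ring.
  rewrite Cexp_plus. simpl. ring.
Qed.

(** Each term deviates from its linear part by a Taylor remainder of the exponential; the remainders
    sum to a multiple of the square of [Cmod h], which still vanishes after division by [h]. *)
Lemma Cderiv_series c eta B w j : 0 < eta -> 0 <= B -> fast_decay c eta B w ->
  Cderiv (fun z => Csum (term c j z)) w (Csum (term c (S j) w)).
Proof.
  intros He HB Hc eps Heps.
  set (S2 := Series (fun n => Cmod (lam n) ^ (j + 2) * exp (- (eta / 2) * Cmod (lam n)))).
  assert (HS2 : 0 <= S2).
  { assert (P : forall n, 0 <= Cmod (lam n) ^ (j + 2) * exp (- (eta / 2) * Cmod (lam n))).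
    { intros n. apply Rmult_le_pos; [apply pow_le, Cmod_ge_0|left; apply exp_pos]. }
    eapply Rle_trans; [apply (P 0%nat)|].
    apply (term_le_Series _ 0 P). apply ex_series_pow_exp. lra. }
  assert (HBS : 0 <= B * S2) by (apply Rmult_le_pos; assumption).
  (* [eta / 2] lets the decay absorb the exponential in the Taylor remainder. The 8 is 4 from
     [Cexp_taylor] times 2 from [Csum_Cmod_le]; the added 1 avoids a zero denominator. *)
  exists (Rmin (eta / 2) (eps / (8 * (B * S2) + 1))).
  split; [apply Rmin_glb_lt; [lra|apply Rdiv_lt_0_compat; lra]|].
  intros h [Hh0 Hh]. rewrite !Cnorm_Cmod in *.
  assert (Hh1 : Cmod h <= eta / 2) by (pose proof (Rmin_l (eta / 2) (eps / (8 * (B * S2) + 1))); lra).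
  assert (Hh2 : Cmod h < eps / (8 * (B * S2) + 1))
    by (pose proof (Rmin_r (eta / 2) (eps / (8 * (B * S2) + 1))); lra).
  assert (Hhn : h <> RtoC 0) by (apply Cmod_gt_0; exact Hh0).
  pose proof (ex_series_term c eta B w j He Hc) as E0.
  pose proof (ex_series_term c eta B w (S j) He Hc) as E1.
  assert (Hch : fast_decay c (eta / 2) B (w + h)%C) by now apply fast_decay_near.
  pose proof (ex_series_term c (eta / 2) B (w + h)%C j ltac:(lra) Hch) as Eh.
  set (d := fun n => (term c j (w + h) n - term c j w n - h * term c (S j) w n)%C).
  assert (Hd : forall n, Cmod (d n) <= 4 * (Cmod h * Cmod h) *
    (Cmod (lam n) ^ (j + 2) * (B * exp (- (eta / 2) * Cmod (lam n))))).
  { intros n. unfold d. rewrite term_increment, Cmod_mult, Cmod_term.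
    pose proof (Cexp_taylor (lam n * h)) as T. rewrite !Cmod_mult in T.
    set (L := Cmod (lam n)) in *. assert (HL : 0 <= L) by apply Cmod_ge_0.
    specialize (Hc n). fold L in Hc. set (q := Cmod (c n) * exp (fst (lam n * w)%C)) in *.
    assert (Hq : 0 <= q) by (apply Rmult_le_pos; [apply Cmod_ge_0|left; apply exp_pos]).
    apply Rle_trans with (L ^ j * q * (4 * (L * Cmod h * (L * Cmod h) * exp (L * Cmod h)))).
    { apply Rmult_le_compat_l; [apply Rmult_le_pos; [now apply pow_le|exact Hq]|exact T]. }
    rewrite pow_add. simpl.
    replace (L ^ j * q * (4 * (L * Cmod h * (L * Cmod h) * exp (L * Cmod h)))) with
      (4 * (Cmod h * Cmod h) * (L ^ j * (L * (L * 1))) * (q * exp (L * Cmod h))) by ring.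
    rewrite <- (Rmult_assoc (4 * (Cmod h * Cmod h)) _ (B * _)). apply Rmult_le_compat_l.
    - apply Rmult_le_pos; [nra|]. apply Rmult_le_pos; [now apply pow_le|nra].
    - apply Rle_trans with (B * exp (- eta * L) * exp (eta / 2 * L)).
      + apply Rmult_le_compat; [exact Hq|left; apply exp_pos|exact Hc|].
        apply exp_le. nra.
      + rewrite Rmult_assoc, <- exp_plus. right. do 2 f_equal. field. }
  destruct (ex_series_dominated c (eta / 2) B (w + h)%C (j + 2) d _ ltac:(lra) Hch Hd) as [Ed HSd].
  fold S2 in HSd.
  assert (Esc : ex_series (fun n => Cmod (h * term c (S j) w n))).
  { eapply ex_series_ext; [intros n; symmetry; apply Cmod_mult|].
    apply (ex_series_scal_l (V := R_NormedModule)). exact E1. }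
  assert (Edif : ex_series (fun n => Cmod (term c j (w + h) n - term c j w n))).
  { apply (ex_series_le (V := R_CompleteNormedModule)) with
      (fun n => Cmod (term c j (w + h)%C n) + Cmod (term c j w n)).
    - intros n. change norm with Rabs; simpl. rewrite Rabs_pos_eq by apply Cmod_ge_0.
      eapply Rle_trans; [apply Cmod_triangle|]. rewrite Cmod_opp. lra.
    - apply (ex_series_plus (V := R_NormedModule)); assumption. }
  assert (Hsum : Csum d = (Csum (term c j (w + h)%C) - Csum (term c j w) - h * Csum (term c (S j) w))%C).
  { unfold d. rewrite Csum_minus, Csum_minus, Csum_scal by assumption. reflexivity. }
  assert (Hq : Csub (Cdiv (Csub (Csum (term c j (Cadd w h))) (Csum (term c j w))) h)
                    (Csum (term c (S j) w)) = (/ h * Csum d)%C).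
  { rewrite Hsum.
    assert (Ei : Defs.Cinv h = Complex.Cinv h).
    { unfold Defs.Cinv, Complex.Cinv. simpl. now rewrite !Rmult_1_r. }
    unfold Defs.Cdiv. rewrite Ei.
    change (Cadd w h) with (w + h)%C.
    change ((Csum (term c j (w + h)%C) - Csum (term c j w)) * / h - Csum (term c (S j) w) =
      / h * (Csum (term c j (w + h)%C) - Csum (term c j w) - h * Csum (term c (S j) w)))%C.
    field. exact Hhn. }
  rewrite Hq, Cmod_mult, Cmod_inv by exact Hhn.
  pose proof (Csum_Cmod_le d Ed) as HC.
  apply Rle_lt_trans with (/ Cmod h * (8 * (Cmod h * Cmod h) * (B * S2))).
  - apply Rmult_le_compat_l; [left; now apply Rinv_0_lt_compat|]. lra.
  - replace (/ Cmod h * (8 * (Cmod h * Cmod h) * (B * S2))) with (Cmod h * (8 * (B * S2)))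
      by (field; lra).
    apply Rle_lt_trans with (Cmod h * (8 * (B * S2) + 1)).
    + apply Rmult_le_compat_l; lra.
    + apply Rmult_lt_reg_r with (/ (8 * (B * S2) + 1)); [apply Rinv_0_lt_compat; lra|].
      rewrite Rmult_assoc, Rinv_r, Rmult_1_r by lra. exact Hh2.
Qed.

(** The order [i] is generalised because each differentiation raises it by one; the derivative
    exists on the whole disc of radius [eta / 2], where decay persists. *)
Lemma nth_deriv_series c j : forall i eta B z, 0 < eta -> 0 <= B -> fast_decay c eta B z ->
  nth_deriv_at j (fun z => Csum (term c i z)) z (Csum (term c (i + j) z)).
Proof.
  induction j as [|j IH]; intros i eta B z He HB Hc; simpl.
  - now rewrite Nat.add_0_r.
  - exists (eta / 2). split; [lra|]. exists (fun z => Csum (term c (S i) z)). split.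
    + intros w Hw. rewrite Cnorm_Cmod in Hw. apply Cderiv_series with (eta / 2) B; [lra|exact HB|].
      replace w with (z + (w - z))%C by ring.
      apply fast_decay_near; [left; exact Hw|exact Hc].
    + rewrite Nat.add_succ_r. apply (IH (S i) eta B); assumption.
Qed.

(** * Nodes drifting in the limit direction *)

Section Nodes.
Variables (mu : nat -> C) (m : nat -> nat).
Let x k := fst (s * mu k)%C.
Hypothesis m_pos : forall k, (1 <= m k)%nat.
Hypothesis x_inj : forall j k, x j = x k -> j = k.
Hypothesis x_drift : forall p, exists K, forall k, (K <= k)%nat -> x p < x k.

(** All but finitely many nodes lie to the right of node [p], so a minimum over finitely many
    indices that also stays at or below [x p] is a global one. *)
Lemma leftmost_node (P : nat -> Prop) p : P p -> exists q, P q /\ forall k, P k -> x q <= x k.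
Proof.
  intros Hp. destruct (x_drift p) as [K HK].
  assert (H : forall M, exists q, P q /\ x q <= x p /\ forall k, (k < M)%nat -> P k -> x q <= x k).
  { induction M as [|M (q & Hq & Hqp & H)].
    - exists p. split; [exact Hp|]. split; [lra|intros; lia].
    - destruct (classic (P M /\ x M < x q)) as [[HM Hlt]|Hno].
      + exists M. split; [exact HM|]. split; [lra|]. intros k Hk Pk.
        destruct (Nat.eq_dec k M) as [->|]; [lra|]. specialize (H k ltac:(lia) Pk). lra.
      + exists q. split; [exact Hq|]. split; [exact Hqp|]. intros k Hk Pk.
        destruct (Nat.eq_dec k M) as [->|]; [|apply H; [lia|exact Pk]].
        apply Rnot_lt_le. intros Hlt. now apply Hno. }
  destruct (H K) as (q & Hq & Hqp & HqK). exists q. split; [exact Hq|]. intros k Pk.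
  destruct (Nat.lt_ge_cases k K) as [Hk|Hk]; [now apply HqK|]. specialize (HK k Hk). lra.
Qed.

Lemma next_node p : exists q, x p < x q /\ forall k, x p < x k -> x q <= x k.
Proof.
  destruct (x_drift p) as [K HK]. apply (leftmost_node (fun k => x p < x k) K). apply HK. lia.
Qed.

(** A node never reached would have the whole strictly increasing orbit on its left, whereas only
    indices below some [K] can lie there: [K + 1] distinct orbit points contradict the pigeonhole
    principle. *)
Lemma node_enumeration (k0 : nat) (nx : nat -> nat) : (forall k, x k0 <= x k) ->
  (forall p, x p < x (nx p) /\ forall k, x p < x k -> x (nx p) <= x k) ->
  forall k, exists t, Nat.iter t nx k0 = k.
Proof.
  intros H0 Hnx k. apply NNPP. intros Hno.
  set (node := fun t => Nat.iter t nx k0).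
  assert (Hlt : forall t, x (node t) < x k).
  { assert (Hne : forall t, x (node t) <> x k) by (intros t E; apply Hno; exists t; now apply x_inj).
    induction t as [|t IH].
    - specialize (H0 k). specialize (Hne 0%nat). unfold node in *; simpl in *. lra.
    - specialize (Hne (S t)). pose proof (proj2 (Hnx (node t)) k IH) as H.
      change (x (node (S t)) <= x k) in H. lra. }
  assert (Hmono : forall t t', (t < t')%nat -> x (node t) < x (node t')).
  { induction 1 as [|t' H IH]; [apply (Hnx (node t))|].
    pose proof (proj1 (Hnx (node t'))) as H1. change (nx (node t')) with (node (S t')) in H1. lra. }
  destruct (x_drift k) as [K HK].
  assert (HN : NoDup (map node (seq 0 (S K)))).
  { apply Injective_map_NoDup; [|apply seq_NoDup]. intros t t' E.
    destruct (Nat.lt_trichotomy t t') as [H|[H|H]]; [|exact H|];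
      apply Hmono in H; rewrite E in H; lra. }
  apply NoDup_incl_length with (l' := seq 0 K) in HN.
  - rewrite length_map, !length_seq in HN. lia.
  - intros y Hy. apply in_map_iff in Hy. destruct Hy as (t & <- & _). apply in_seq.
    split; [lia|]. simpl. destruct (Nat.lt_ge_cases (node t) K) as [H|H]; [exact H|].
    specialize (HK _ H). specialize (Hlt t). lra.
Qed.

(** The lexicographic walk: all derivative orders at a node in turn, then order 0 at the next
    node. *)
Lemma row_enumeration (nx : nat -> nat) (k0 : nat) :
  (forall k, exists t, Nat.iter t nx k0 = k) ->
  exists r : nat -> nat * nat, (forall i, (snd (r i) < m (fst (r i)))%nat) /\
    (forall i, r (S i) = (fst (r i), S (snd (r i))) \/ r (S i) = (nx (fst (r i)), 0%nat)) /\
    (forall k j, (j < m k)%nat -> exists i, r i = (k, j)).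
Proof.
  intros Henum.
  set (next := fun p : nat * nat => let (k, j) := p in
    if Compare_dec.lt_dec (S j) (m k) then (k, S j) else (nx k, 0%nat)).
  set (r := fun i => Nat.iter i next (k0, 0%nat)).
  assert (HS : forall i, r (S i) = next (r i)) by reflexivity.
  exists r. split; [|split].
  - induction i as [|i IH]; [apply m_pos|]. rewrite HS. destruct (r i) as [k j]; simpl.
    destruct (Compare_dec.lt_dec (S j) (m k)); simpl; [assumption|apply m_pos].
  - intros i. rewrite HS. destruct (r i) as [k j]; simpl. destruct (Compare_dec.lt_dec (S j) (m k)); auto.
  - assert (Hrun : forall i k, r i = (k, 0%nat) -> forall j, (j < m k)%nat -> r (j + i)%nat = (k, j)).
    { intros i k Hi j. induction j as [|j IH]; intros Hj; [exact Hi|].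
      change (S j + i)%nat with (S (j + i)). rewrite HS, IH by lia. simpl.
      destruct (Compare_dec.lt_dec (S j) (m k)); [reflexivity|lia]. }
    assert (Hnode : forall t, exists i, r i = (Nat.iter t nx k0, 0%nat)).
    { induction t as [|t [i Hi]]; [now exists 0%nat|].
      (* After [m - 1] steps the walk is at the last order of the node; one more step enters the
         next node. *)
      exists (S ((m (Nat.iter t nx k0) - 1) + i)). rewrite HS.
      pose proof (m_pos (Nat.iter t nx k0)).
      rewrite (Hrun i _ Hi) by lia. simpl. destruct (Compare_dec.lt_dec _ _); [lia|reflexivity]. }
    intros k j Hj. destruct (Henum k) as [t <-]. destruct (Hnode t) as [i Hi].
    exists (j + i)%nat. now apply Hrun.
Qed.

(** The conditions, taken in lexicographic order, form a system for [polya_system]. Convergence at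
    the next node then gives decay around each node, hence convergence nearby and termwise
    differentiation. *)
Lemma drift_soluble : interpolation_soluble lam mu m.
Proof.
  intros b.
  destruct (leftmost_node (fun _ => True) 0%nat I) as (k0 & _ & Hk0).
  destruct (choice _ next_node) as [nx Hnx].
  destruct (row_enumeration nx k0 (node_enumeration k0 nx (fun k => Hk0 k I) Hnx))
    as (r & Hr & Hrn & Hrs).
  set (a := fun i n => (lam n ^ snd (r i) * Cexp (lam n * mu (fst (r i))))%C).
  assert (Hshift : forall k q, x k < x q -> fst (s * (mu k - mu q))%C < 0).
  { intros k q H. unfold x, Cmult, Cminus, Cplus, Copp in *; simpl in *. lra. }
  assert (Hbig := linear_eventually_large (fun n => Cmod (lam n)) rho rho_pos lam_linear).
  assert (Hamod : forall i n, Cmod (a i n) =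
    Cmod (lam n) ^ snd (r i) * exp (fst (lam n * mu (fst (r i)))%C)).
  { intros i n. unfold a. now rewrite Cmod_mult, Cmod_pow, Cmod_Cexp. }
  destruct (polya_system a) with (b := fun i => b (fst (r i)) (snd (r i))) as [c Hc].
  - intros i. destruct (Hbig 0) as [N HN]. exists N. intros n Hn.
    apply Cmod_gt_0. rewrite Hamod. apply Rmult_lt_0_compat; [apply pow_lt, HN, Hn|apply exp_pos].
  - intros i eps He. destruct (Hrn i) as [E|E].
    + destruct (Hbig (/ eps)) as [N HN]. exists N. intros n Hn. rewrite !Hamod, E. simpl.
      specialize (HN n Hn). simpl in HN. set (L := Cmod (lam n)) in *.
      assert (0 < / eps) by now apply Rinv_0_lt_compat.
      rewrite <- !Rmult_assoc. apply Rmult_le_compat_r; [left; apply exp_pos|].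
      assert (1 <= eps * L).
      { rewrite <- (Rinv_r eps) by lra. apply Rmult_le_compat_l; lra. }
      rewrite <- (Rmult_1_l (L ^ snd (r i))) at 1.
      apply Rmult_le_compat_r; [apply pow_le; lra|assumption].
    + destruct (r i) as [k j] eqn:Eri. simpl in E.
      destruct (lam_decay (mu k - mu (nx k))%C) as (eta & B & Heta & HB & Hdec);
        [apply Hshift, Hnx|].
      (* Passing to the next node gains an exponential. The extra power [S j] bounds the ratio of
         the rows by [B * B'] over [Cmod (lam n)], which is eventually below [eps]. *)
      destruct (pow_exp_bounded (S j) eta Heta) as (B' & HB' & Hpe).
      destruct (Hbig (B * B' / eps)) as [N HN]. exists N. intros n Hn. rewrite !Hamod, Eri, E.
      cbn [fst snd pow]. rewrite Rmult_1_l. specialize (HN n Hn). cbv beta in HN.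
      specialize (Hdec n).
      specialize (Hpe (Cmod (lam n)) (Cmod_ge_0 _)). cbn [pow] in Hpe. set (L := Cmod (lam n)) in *.
      assert (HBB : 0 < B * B' / eps) by (apply Rdiv_lt_0_compat; [apply Rmult_lt_0_compat|]; lra).
      replace (fst (lam n * mu k)%C) with (fst (lam n * (mu k - mu (nx k)))%C + fst (lam n * mu (nx k))%C)
        by (unfold Cmult, Cminus, Cplus, Copp; simpl; ring).
      rewrite exp_plus, <- Rmult_assoc. apply Rmult_le_compat_r; [left; apply exp_pos|].
      apply Rmult_le_reg_l with L; [lra|].
      apply Rle_trans with (B * (L * L ^ j * exp (- eta * L))).
      * replace (B * (L * L ^ j * exp (- eta * L))) with (L * (L ^ j * (B * exp (- eta * L)))) by ring.
        apply Rmult_le_compat_l; [lra|]. apply Rmult_le_compat_l; [apply pow_le; lra|exact Hdec].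
      * apply Rle_trans with (B * B'); [apply Rmult_le_compat_l; lra|].
        replace (B * B') with (B * B' / eps * eps) by (field; lra).
        apply Rmult_le_compat_r; lra.
  - assert (Hrow : forall k j, (j < m k)%nat -> Cseries_abs_sum (term c j (mu k)) (b k j)).
    { intros k j Hj. destruct (Hrs k j Hj) as [i Hi]. specialize (Hc i).
      replace (term c j (mu k)) with (fun n => (a i n * c n)%C).
      - rewrite Hi in Hc. exact Hc.
      - apply functional_extensionality. intros n. unfold a, term. rewrite Hi. simpl. ring. }
    assert (Hterm0 : forall z, (fun n => Cmul (c n) (Cexp (Cmul (lam n) z))) = term c 0 z).
    { intros z. apply functional_extensionality. intros n.
      change (c n * Cexp (lam n * z) = term c 0 z n :> C)%C. unfold term. simpl. ring. }
    assert (Hdecay : forall k, exists eta B, 0 < eta /\ 0 <= B /\ fast_decay c eta B (mu k)).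
    (* Every node has one strictly to its right, and convergence there bounds the terms and yields
       exponential decay at [mu k]. *)
    { intros k. specialize (Hrow (nx k) 0%nat (m_pos _)). rewrite <- Hterm0 in Hrow.
      destruct (solution_terms_bounded c (mu (nx k)) _ Hrow) as (B0 & HB0 & HB0n).
      destruct (lam_decay (mu k - mu (nx k))%C) as (eta & B & Heta & HB & Hdec);
        [apply Hshift, Hnx|].
      exists eta, (B0 * B). split; [exact Heta|]. split; [apply Rmult_le_pos; lra|]. intros n.
      eapply Rle_trans; [apply (solution_terms_shift c _ _ _ HB0n)|].
      rewrite Rmult_assoc. apply Rmult_le_compat_l; [lra|]. apply Hdec. }
    exists c, (fun z => Csum (term c 0 z)). split.
    + intros k. destruct (Hdecay k) as (eta & B & Heta & HB & Hfd).
      exists (eta / 2). split; [lra|]. intros z Hz. rewrite Cnorm_Cmod in Hz. rewrite Hterm0.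
      apply Csum_correct, (ex_series_term c (eta / 2) B); [lra|].
      replace z with (mu k + (z - mu k))%C by ring.
      apply fast_decay_near; [left; exact Hz|exact Hfd].
    + intros k j Hj. destruct (Hdecay k) as (eta & B & Heta & HB & Hfd).
      rewrite (Cseries_abs_sum_unique _ _ _ (Hrow k j Hj)
        (Csum_correct _ (ex_series_term c eta B (mu k) j Heta Hfd))).
      apply (nth_deriv_series c j 0 eta B); assumption.
Qed.
End Nodes.
End Exponentials.

(** * Solubility as a condition on the real parts, and the two cases of the theorem *)

Lemma soluble_iff_drift (Lambda : Cx -> Prop) (s : Cx) (lam mu : nat -> Cx) (m : nat -> nat) :
  (forall t : Cx, limit_direction Lambda t <-> t = s) ->
  (forall n, Lambda (lam n)) ->
  (forall n, Cnorm (lam (S n)) > 2 * Cnorm (lam n)) ->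
  (forall k, (1 <= m k)%nat) ->
  (forall j k, Re (Cmul s (mu j)) = Re (Cmul s (mu k)) -> j = k) ->
  interpolation_soluble lam mu m <->
  forall p, exists K, forall k, (K <= k)%nat -> Re (Cmul s (mu p)) < Re (Cmul s (mu k)).
Proof.
  intros HP HL Hgrow Hm Hline.
  destruct (lacunary_linear lam Hgrow) as (rho & Hrho & Hlin).
  assert (Hdec := directional_decay lam s
    (unique_limit_direction Lambda s lam rho (fun t => proj1 (HP t)) HL Hrho Hlin)).
  split.
  - intros Hsol p.
    destruct (soluble_nodes_drift s lam rho Hrho Hlin Hdec mu m Hm Hsol p) as [K HK].
    (* Indices are also taken beyond [p], so equality of real parts is excluded by the hypothesis on
       lines and the inequality becomes strict. *)
    exists (K + S p)%nat. intros k Hk. specialize (HK k ltac:(lia)).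
    destruct HK as [HK|HK]; [exact HK|]. apply Hline in HK. lia.
  - intros Hd. apply (drift_soluble s lam rho Hrho Hlin Hdec mu m Hm); assumption.
Qed.

Theorem theorem2
  (Lambda : Cx -> Prop) (s : Cx)
  (HLunb : unbounded Lambda)
  (HP : forall t : Cx, limit_direction Lambda t <-> t = s)
  (lam : nat -> Cx)
  (HlamL : forall n, Lambda (lam n))
  (Hlamgrow : forall n, Cnorm (lam (S n)) > 2 * Cnorm (lam n))
  (mu : nat -> Cx) (m : nat -> nat)
  (Hinj : forall j k, mu j = mu k -> j = k)
  (Hm : forall k, (1 <= m k)%nat)
  (Hisol : forall k, exists r : R, r > 0 /\
             forall j, j <> k -> Cnorm (Csub (mu j) (mu k)) >= r)
  (Hline : forall j k, Re (Cmul s (mu j)) = Re (Cmul s (mu k)) -> j = k) :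
  ((forall D : R, exists k, Re (Cmul s (mu k)) > D) ->
     (interpolation_soluble lam mu m <->
      forall D : R, exists K : nat, forall k, (k >= K)%nat -> Re (Cmul s (mu k)) > D))
  /\
  (forall d : R, is_lub (fun x => exists k, x = Re (Cmul s (mu k))) d ->
     (interpolation_soluble lam mu m <->
      (forall k, Re (Cmul s (mu k)) < d) /\ Un_cv (fun k => Re (Cmul s (mu k))) d)).
Proof.
  pose proof (soluble_iff_drift Lambda s lam mu m HP HlamL Hlamgrow Hm Hline) as Hiff.
  set (x := fun k => Re (Cmul s (mu k))) in *.
  split.
  - intros Hunb. rewrite Hiff. split.
    + intros Hd D. destruct (Hunb D) as [p Hp]. destruct (Hd p) as [K HK].
      exists K. intros k Hk. specialize (HK k Hk). unfold x in *. lra.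
    + intros Hlim p. destruct (Hlim (x p)) as [K HK]. exists K. exact HK.
  - intros d [Hub Hleast]. rewrite Hiff. split.
    + intros Hd.
      (* The supremum is not attained, since each node has another one strictly to its right. *)
      assert (Hlt : forall k, x k < d).
      { intros p. destruct (Hd p) as [K HK]. specialize (HK K (le_n K)).
        assert (x K <= d) by (apply Hub; now exists K). unfold x in *. lra. }
      split; [exact Hlt|]. intros eps He.
      (* One node within [eps] of the supremum suffices: almost all nodes lie between it and [d]. *)
      assert (Hp : exists p, d - eps < x p).
      { apply NNPP. intros Hno. assert (d <= d - eps); [|lra]. apply Hleast.
        intros y [k ->]. apply Rnot_lt_le. intros H. apply Hno. now exists k. }
      destruct Hp as [p Hp]. destruct (Hd p) as [K HK]. exists K. intros k Hk.
      specialize (HK k Hk). specialize (Hlt k). unfold Rdist. apply Rabs_def1; unfold x in *; lra.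
    + intros [Hlt Hcv] p. destruct (Hcv (d - x p)) as [K HK]; [specialize (Hlt p); unfold x; lra|].
      exists K. intros k Hk. specialize (HK k Hk). unfold Rdist in HK. apply Rabs_def2 in HK.
      unfold x in *. lra.
Qed.
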